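(* Consider the following promise problem. Input: a string $x$, the number $k=K(x)$, and an integer $\alpha\in[\varepsilon,k-\varepsilon]$, where $\varepsilon=|x|/(10\log|x|)$. Output: $1$ if $\lambda_x(\alpha-\varepsilon)<k+6\log k$; $0$ if $\lambda_x(\alpha+\varepsilon)>k+3\varepsilon$; if neither case occurs, any output (or none) is allowed. There is no algorithm $A$ that solves this promise problem for all $x$ (i.e., halts with the required output on every input falling into one of the two cases).
   Context: $K$ is prefix Kolmogorov complexity w.r.t. a fixed reference universal prefix machine. For a finite set $S$, $K(S)$ is the length of a shortest program listing $S$, $\Lambda(S)=K(S)+\log|S|$ (log base 2), and $\lambda_x(\alpha)=\min\{\Lambda(S): S\text{ finite},x\in S,K(S)\le\alpha\}$. *)

(* Defs.v *)
From mathcomp Require Import all_boot all_order all_algebra finmap.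
From mathcomp Require Import boolp classical_sets reals ereal exp.

Set Implicit Arguments.
Unset Strict Implicit.
Unset Printing Implicit Defensive.

Import Order.TTheory GRing.Theory Num.Theory.

Local Open Scope nat_scope.

(* Kleene's partial recursive functions N^n -> N.  A partial function is
   given by its graph [f v y], "f(v) is defined and equals y". *)
Inductive partial_recursive : forall n, (n.-tuple nat -> nat -> Prop) -> Prop :=
| pr_zero n : partial_recursive (fun (_ : n.-tuple nat) y => y = 0)
| pr_succ : partial_recursive (fun (v : 1.-tuple nat) y => y = (thead v).+1)
| pr_proj n (i : 'I_n) :
    partial_recursive (fun (v : n.-tuple nat) y => y = tnth v i)
| pr_comp m n (g : m.-tuple nat -> nat -> Prop)
      (h : 'I_m -> n.-tuple nat -> nat -> Prop) :
    partial_recursive g -> (forall i, partial_recursive (h i)) ->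
    partial_recursive (fun (v : n.-tuple nat) y =>
      exists w : m.-tuple nat, (forall i, h i v (tnth w i)) /\ g w y)
  (* f(0, v) = g(v) and f(i + 1, v) = h(i, f(i, v), v); the sequence s lists
     the values f(0, v), f(1, v), ... up to the recursion argument. *)
| pr_rec n (g : n.-tuple nat -> nat -> Prop)
      (h : n.+2.-tuple nat -> nat -> Prop) :
    partial_recursive g -> partial_recursive h ->
    partial_recursive (fun (v : n.+1.-tuple nat) y =>
      exists s : nat -> nat,
        [/\ g [tuple of behead v] (s 0),
            forall i, i < thead v ->
              h [tuple of i :: s i :: behead v] (s i.+1)
          & y = s (thead v)])
  (* y is the least zero of g(-, v), and g(z, v) is defined for all z < y. *)
| pr_min n (g : n.+1.-tuple nat -> nat -> Prop) :
    partial_recursive g ->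
    partial_recursive (fun (v : n.-tuple nat) y =>
      g [tuple of y :: v] 0 /\
      forall z, z < y -> exists k, g [tuple of z :: v] k.+1).

Definition bitstring := seq bool.

(* The standard bijection between strings and numbers
   (empty, 0), ("0", 1), ("1", 2), ("00", 3), ("01", 4), ... *)
Definition nat_of_bitstring (x : bitstring) : nat :=
  foldl (fun n (b : bool) => n.*2.+1 + b) 0 x.

(* A machine is a partial function from programs to output strings, again
   given by its graph. *)
Definition machine := bitstring -> bitstring -> Prop.

Definition computable_machine (T : machine) : Prop :=
  exists2 f : 1.-tuple nat -> nat -> Prop, partial_recursive f &
    forall p y, T p y <-> f [tuple nat_of_bitstring p] (nat_of_bitstring y).

Definition prefix_machine (T : machine) : Prop :=
  computable_machine T /\
  forall p q y z, T p y -> T q z -> prefix p q -> p = q.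

Definition universal_prefix_machine (U : machine) : Prop :=
  prefix_machine U /\
  forall T, prefix_machine T ->
    exists w : bitstring, forall p y, T p y <-> U (w ++ p) y.

(* The length of a shortest program satisfying P.  The value when no program
   satisfies P is irrelevant: it does not arise for K and KS below when U is
   universal. *)
Definition shortest_length (P : bitstring -> Prop) : nat :=
  xget 0 [set n | (exists2 p, P p & size p = n) /\
                  (forall p, P p -> n <= size p)]%classic.

Definition K (U : machine) (x : bitstring) : nat :=
  shortest_length (fun p => U p x).

(* 1^{|x|} 0 x *)
Definition self_delimiting (x : bitstring) : bitstring :=
  nseq (size x) true ++ false :: x.

Definition listing (s : seq bitstring) : bitstring :=
  flatten (map self_delimiting s).

(* p lists the elements of S, without repetition and in some order. *)
Definition lists (U : machine) (p : bitstring) (S : {fset bitstring}) : Prop :=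
  exists2 s : seq bitstring, perm_eq s (enum_fset S) & U p (listing s).

Definition KS (U : machine) (S : {fset bitstring}) : nat :=
  shortest_length (fun p => lists U p S).

Local Open Scope ring_scope.

Definition log2 {R : realType} (r : R) : R := ln r / ln 2.

Definition Lambda (R : realType) (U : machine) (S : {fset bitstring}) : R :=
  (KS U S)%:R + log2 (#|` S|%fset)%:R.

(* The minimum, with value +oo when no S qualifies.  For universal U only
   finitely many S satisfy the constraints, so a nonempty infimum is attained. *)
Definition lambda {R : realType} (U : machine) (x : bitstring) (a : R) : \bar R :=
  ereal_inf [set (Lambda R U S)%:E | S in
    [set S : {fset bitstring} | (x \in S) /\ (KS U S)%:R <= a]]%classic.

Definition epsilon (R : realType) (x : bitstring) : R :=
  (size x)%:R / (10 * log2 (size x)%:R).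

(* Main.v *)
Require Import Defs.
From mathcomp Require Import all_boot all_order all_algebra finmap.
From mathcomp Require Import boolp classical_sets reals ereal exp.
From mathcomp Require Import zify lra.

(* Let e bound epsilon from above.  Suppose that A decides the promise problem.  A run that
   simulates A and U fills 2^M slots with strings of length n, so that every string gets
   complexity at most k_0 = M + O(log n) (the number of its slot).  The slots are grouped in
   nested blocks, of size s_i = 2^(4ei) at level i < L = O(log n); put k_i = k_0 - i and
   alpha_i = M - 2e - 4ei.  The run continues after a block of level i only when, for every x
   in it, A has answered 0 on (x, k_i, alpha_i) or K(x) < k_i has been observed, and after a block
   of level i + 1 only when K(x) < k_i has been observed for every x in it.

   The first wait ends.  If K(x) = k_i and A does not answer 0, then x has a model of complexity
   at most alpha_i + e and Lambda at most k_i + 3e.  New strings are chosen outside the models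
   known so far, and whenever a program of length at most alpha_i + e halts, the current
   block of level i is discarded.  There are fewer than 2^(alpha_i + e + 1) such programs, so
   that only a small fraction of the slots is discarded at each level.

   The second wait ends as well.  The block of level i + 1 is a model of x, described by its
   number, of complexity at most alpha_i - e and Lambda at most k_i + O(log n); hence A may
   not answer 0 on (x, k_i, alpha_i) if K(x) = k_i.

   So the slots get filled, and at least 2^(M-1) strings have K(x) < k_(L-1) = M - 1, which is
   more than there are such short programs. *)

Set Implicit Arguments.
Unset Strict Implicit.
Unset Printing Implicit Defensive.

Local Open Scope nat_scope.

(** * Total recursive functions *)

Definition rec n (f : n.-tuple nat -> nat) :=
  partial_recursive (fun v y => y = f v).

Lemma pr_ext n (f g : n.-tuple nat -> nat -> Prop) :
  (forall v y, f v y <-> g v y) -> partial_recursive f -> partial_recursive g.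
Proof.
move=> fg; suff -> : f = g by [].
by apply/funext => v; apply/funext => y; apply/propext.
Qed.

Lemma rec_ext n (f g : n.-tuple nat -> nat) : f =1 g -> rec f -> rec g.
Proof. by move=> fg; apply: pr_ext => v y; rewrite fg. Qed.

Lemma rec_proj n (i : 'I_n) : rec (fun v => tnth v i).
Proof. exact: pr_proj. Qed.

Lemma rec_comp m n (g : m.-tuple nat -> nat) (h : 'I_m -> n.-tuple nat -> nat) :
  rec g -> (forall i, rec (h i)) -> rec (fun v => g [tuple h i v | i < m]).
Proof.
move=> rg rh; apply: pr_ext (pr_comp rg rh) => v y; split=> [[w [hw ->]]|->].
  by congr g; apply: eq_from_tnth => i; rewrite tnth_mktuple hw.
by exists [tuple h i v | i < m]; split=> // i; rewrite tnth_mktuple.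
Qed.

Lemma rec_succ n (f : n.-tuple nat -> nat) : rec f -> rec (fun v => (f v).+1).
Proof.
move=> rf; apply: rec_ext (rec_comp (h := fun=> f) pr_succ (fun=> rf)) => v.
by rewrite /thead tnth_mktuple.
Qed.

Lemma rec_const n k : rec (fun _ : n.-tuple nat => k).
Proof. by elim: k => [|k IH]; [exact: pr_zero | exact: rec_succ]. Qed.

Lemma rec_prim n (g : n.-tuple nat -> nat) (h : n.+2.-tuple nat -> nat) :
  rec g -> rec h ->
  rec (fun v : n.+1.-tuple nat =>
    nat_rect (fun=> nat) (g [tuple of behead v])
      (fun i r => h [tuple of i :: r :: behead v]) (thead v)).
Proof.
move=> rg rh; apply: pr_ext (pr_rec rg rh) => v y; split=> [[s [s0 sS ->]]|->].
  elim: (thead v) sS => [|k IH] sS //=.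
  by rewrite sS// IH// => i ik; rewrite sS// ltnW.
by exists (nat_rect (fun=> nat) (g [tuple of behead v])
      (fun i r => h [tuple of i :: r :: behead v])).
Qed.

(** Primitive recursion whose bound is itself a function of the arguments. It is [rec_prim] composed
    with the tuple that puts [N v] in front of [v]. *)
Lemma rec_natrec n (N g : n.-tuple nat -> nat) (h : nat -> nat -> n.-tuple nat -> nat) :
  rec N -> rec g ->
  rec (fun w : n.+2.-tuple nat => h (tnth w ord0) (tnth w (lift ord0 ord0))
     [tuple of behead (behead w)]) ->
  rec (fun v => nat_rect (fun=> nat) (g v) (fun i r => h i r v) (N v)).
Proof.
move=> rN rg rh.
have H := rec_comp (h := fun i : 'I_n.+1 =>
  if unlift ord0 i is Some j then (fun v : n.-tuple nat => tnth v j) else N) (rec_prim rg rh).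
apply: rec_ext (H _); last first.
  by move=> i; case: unliftP => [j|] _ //; exact: rec_proj.
move=> v; set w := mktuple _.
have -> : thead w = N v by rewrite /thead tnth_mktuple unlift_none.
have bw : [tuple of behead w] = v.
  apply: eq_from_tnth => i; rewrite tnth_behead tnth_mktuple.
  have -> : inord i.+1 = lift ord0 i by apply: val_inj; rewrite /= inordK// ltnS.
  by rewrite liftK.
rewrite bw; elim: (N v) => [|k IH] //=; rewrite IH; congr h.
by apply: val_inj; rewrite -[in RHS]bw.
Qed.

Lemma rec_comp1 n (g : nat -> nat) (f : n.-tuple nat -> nat) :
  rec (fun v : 1.-tuple nat => g (thead v)) -> rec f -> rec (fun v => g (f v)).
Proof.
move=> rg rf; apply: rec_ext (rec_comp (h := fun=> f) rg (fun=> rf)) => v.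
by rewrite /thead tnth_mktuple.
Qed.

Lemma rec_behead n (f : n.-tuple nat -> nat) : rec f ->
  rec (fun w : n.+1.-tuple nat => f [tuple of behead w]).
Proof.
move=> rf; apply: rec_ext (rec_comp (h := fun i (w : n.+1.-tuple nat) => tnth w (lift ord0 i))
    rf _).
  move=> v; congr f; apply: eq_from_tnth => i; rewrite tnth_mktuple tnth_behead.
  by congr tnth; apply: val_inj; rewrite /= inordK// ltnS.
by move=> i; exact: rec_proj.
Qed.

Lemma rec_tuple2 n (g : 2.-tuple nat -> nat) (f1 f2 : n.-tuple nat -> nat) :
  rec g -> rec f1 -> rec f2 -> rec (fun v => g [tuple f1 v; f2 v]).
Proof.
move=> rg r1 r2.
apply: rec_ext (rec_comp (h := fun i : 'I_2 => if val i is 0 then f1 else f2) rg _).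
  by move=> v; congr g; apply: eq_from_tnth => -[[|[]]] //= i2; rewrite tnth_mktuple.
by case=> [[|[]]].
Qed.

Lemma rec_comp2 n (g : nat -> nat -> nat) (f1 f2 : n.-tuple nat -> nat) :
  rec (fun v : 2.-tuple nat => g (tnth v ord0) (tnth v (lift ord0 ord0))) ->
  rec f1 -> rec f2 -> rec (fun v => g (f1 v) (f2 v)).
Proof. by move=> rg r1 r2; exact: (rec_tuple2 rg r1 r2). Qed.

Lemma rec_pred n (f : n.-tuple nat -> nat) : rec f -> rec (fun v => (f v).-1).
Proof.
move=> rf; apply: rec_ext (rec_natrec (h := fun i r v => i) rf (rec_const n 0) _).
  by move=> v; case: (f v).
exact: rec_proj.
Qed.

Lemma rec_add n (f g : n.-tuple nat -> nat) :
  rec f -> rec g -> rec (fun v => f v + g v).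
Proof.
move=> rf rg; apply: rec_ext (rec_natrec (h := fun i r v => r.+1) rg rf _).
  by move=> v; elim: (g v) => [|k /= ->]; rewrite ?addn0 ?addnS.
exact/rec_succ/rec_proj.
Qed.

Lemma rec_sub n (f g : n.-tuple nat -> nat) :
  rec f -> rec g -> rec (fun v => f v - g v).
Proof.
move=> rf rg; apply: rec_ext (rec_natrec (h := fun i r v => r.-1) rg rf _).
  by move=> v; elim: (g v) => [|k /= ->]; rewrite ?subn0 ?subnS.
exact/rec_pred/rec_proj.
Qed.

Lemma rec_mul n (f g : n.-tuple nat -> nat) :
  rec f -> rec g -> rec (fun v => f v * g v).
Proof.
apply: rec_comp2.
apply: rec_ext (rec_natrec (h := fun i r v => r + tnth v ord0)
  (rec_proj (lift ord0 ord0)) (rec_const 2 0) _).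
  by move=> v; elim: (tnth v (lift _ _)) => [|k /= ->]; rewrite ?muln0 // mulnS addnC.
apply: rec_add; first exact: rec_proj.
apply: rec_ext (rec_proj (lift ord0 (lift ord0 ord0))) => v.
by rewrite !tnth_behead; congr tnth; apply: val_inj; rewrite /= !inordK.
Qed.

Definition ifz (c a b : nat) := if c is 0 then a else b.

Lemma rec_ifz n (c f g : n.-tuple nat -> nat) :
  rec c -> rec f -> rec g -> rec (fun v => ifz (c v) (f v) (g v)).
Proof.
move=> rc rf rg; apply: rec_ext (rec_natrec (h := fun _ _ v => g v) rc rf _).
  by move=> v; case: (c v).
apply: rec_ext (rec_behead (rec_behead rg)) => v /=.
by congr g; apply: val_inj.
Qed.

Lemma rec_prod n m (h : 'I_m -> n.-tuple nat -> nat) :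
  (forall i, rec (h i)) -> rec (fun v => \prod_(i < m) h i v).
Proof.
elim: m h => [|m IH] h rh.
  by apply: rec_ext (rec_const n 1) => v; rewrite big_ord0.
apply: rec_ext (rec_mul (rh ord0) (IH (fun i => h (lift ord0 i)) _)) => // v.
by rewrite big_ord_recl.
Qed.

(** * Stages of partial recursive functions *)

(* [F (t, v)] is the result, shifted by one, of running the partial function [f]
   for [t] steps on [v], and [0] if the computation has not halted by then. *)
Definition staged n (f : n.-tuple nat -> nat -> Prop) (F : n.+1.-tuple nat -> nat) :=
  [/\ rec F,
      forall (v : n.-tuple nat) y, f v y <-> exists t, F [tuple of t :: v] = y.+1
    & forall (v : n.-tuple nat) t t', t <= t' -> F [tuple of t :: v] != 0 ->
        F [tuple of t' :: v] = F [tuple of t :: v]].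

Lemma staged_total n (f : n.-tuple nat -> nat) :
  rec f -> exists F, staged (fun v y => y = f v) F.
Proof.
move=> rf; exists (fun w : n.+1.-tuple nat => (f [tuple of behead w]).+1); split.
- exact/rec_succ/rec_behead.
- have E (v : n.-tuple nat) t : [tuple of behead [tuple of t :: v]] = v by exact: val_inj.
  move=> v y; split=> [->|[t]]; first by exists 0; rewrite E.
  by rewrite E => -[].
- by move=> v t t' _ _; congr (f _).+1; exact: val_inj.
Qed.

Lemma eq_tcons n x (v w : n.-tuple nat) : v = w -> [tuple of x :: v] = [tuple of x :: w].
Proof. by move->. Qed.

(** At stage [t] every [h i] gets [t] steps. The product [P] is nonzero exactly when all of them
    have halted, and then [g] gets [t] steps on the values found. *)
Lemma staged_comp m n (g : m.-tuple nat -> nat -> Prop)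
    (h : 'I_m -> n.-tuple nat -> nat -> Prop) :
  (exists G, staged g G) -> (forall i, exists H, staged (h i) H) ->
  exists F, staged (fun v y => exists w : m.-tuple nat,
    (forall i, h i v (tnth w i)) /\ g w y) F.
Proof.
move=> [G [rG GE Gm]] /choice[H HS].
pose P (w : n.+1.-tuple nat) := \prod_(i < m) H i w.
pose V (w : n.+1.-tuple nat) := [tuple (H i w).-1 | i < m].
exists (fun w => ifz (P w) 0 (G [tuple of thead w :: V w])).
have P0 w : P w != 0 <-> forall i, H i w != 0.
  rewrite -lt0n; split=> [|Hi]; last by rewrite prodn_gt0// => i; rewrite lt0n.
  by move=> Pw i; move: Pw; rewrite /P (bigD1 i)//= muln_gt0 lt0n => /andP[].
have Hmono (v : n.-tuple nat) t t' i : t <= t' -> H i [tuple of t :: v] != 0 ->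
    H i [tuple of t' :: v] = H i [tuple of t :: v].
  by case: (HS i) => _ _; exact.
split.
- apply: rec_ifz; first by apply: rec_prod => i; case: (HS i).
    exact: rec_const.
  pose hh i (w : n.+1.-tuple nat) :=
    if unlift ord0 i is Some j then (H j w).-1 else tnth w ord0.
  apply: rec_ext (rec_comp (h := hh) rG _).
    move=> w; congr G; apply: eq_from_tnth => i; rewrite tnth_mktuple /hh.
    by case: unliftP => [j|] ->; rewrite ?tnthS ?tnth_mktuple // tnth0.
  move=> i; rewrite /hh; case: unliftP => [j|] _; last exact: rec_proj.
  by apply: rec_pred; case: (HS j).
- move=> v y; split=> [[w [hw gw]]|[t]].
  + have [t0 Gt0] := (GE w y).1 gw.
    have /choice[ti Hti] : forall i, exists t, H i [tuple of t :: v] = (tnth w i).+1.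
      by move=> i; case: (HS i) => _ /(_ v (tnth w i))[+ _] _; apply.
    pose t := maxn t0 (\max_i ti i).
    have tit i : ti i <= t.
      by rewrite /t leq_max orbC (leq_bigmax_cond (P := xpredT) i).
    have HT i : H i [tuple of t :: v] = (tnth w i).+1.
      by rewrite -(Hti i); apply: Hmono => //; rewrite Hti.
    exists t; have /P0 : forall i, H i [tuple of t :: v] != 0 by move=> i; rewrite HT.
    case: (P _) => //= _ _; rewrite theadE -Gt0.
    have VE : V [tuple of t :: v] = w.
      by apply: eq_from_tnth => i; rewrite tnth_mktuple HT.
    by rewrite (eq_tcons t VE); apply: Gm; rewrite ?leq_maxl// Gt0.
  + have := P0 [tuple of t :: v]; case: (P _) => //= k [/(_ isT) Hn0 _] GV.
    exists (V [tuple of t :: v]); split; last by apply/GE; exists t.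
    move=> i; case: (HS i) => _ /(_ v)/(_ _)/iffRL + _; apply; exists t.
    by rewrite tnth_mktuple prednK// lt0n.
- move=> v t t' tt'; have := P0 [tuple of t :: v]; case: (P _) => //= k [/(_ isT) Hn0 _].
  rewrite !theadE => GV.
  have HE i : H i [tuple of t' :: v] = H i [tuple of t :: v] by exact: Hmono.
  have VE : V [tuple of t' :: v] = V [tuple of t :: v].
    by apply: eq_from_tnth => i; rewrite !tnth_mktuple HE.
  have /P0 : forall i, H i [tuple of t' :: v] != 0 by move=> i; rewrite HE.
  by case: (P _) => //= _ _; rewrite (eq_tcons t' VE); exact: Gm.
Qed.

(** Every evaluation along the recursion gets the same [t] steps. The value 0 of [Q] records that
    one of them has not halted and is passed on. *)
Lemma staged_rec n (g : n.-tuple nat -> nat -> Prop) (h : n.+2.-tuple nat -> nat -> Prop) :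
  (exists G, staged g G) -> (exists H, staged h H) ->
  exists F, staged (fun (v : n.+1.-tuple nat) y =>
      exists s : nat -> nat,
        [/\ g [tuple of behead v] (s 0),
            forall i, i < thead v ->
              h [tuple of i :: s i :: behead v] (s i.+1)
          & y = s (thead v)]) F.
Proof.
move=> [G [rG GE Gm]] [H [rH HE Hm]].
pose Q t (v : n.-tuple nat) k := nat_rect (fun=> nat) (G [tuple of t :: v])
  (fun i r => ifz r 0 (H [tuple of t :: i :: r.-1 :: v])) k.
have Qm (v : n.-tuple nat) t t' k : t <= t' -> Q t v k != 0 -> Q t' v k = Q t v k.
  move=> tt'; elim: k => [|k IH] /=; first exact: Gm.
  case E : (Q t v k) IH => [|r] //= ->//=; exact: Hm.
have QE (v : n.-tuple nat) k y : (exists s : nat -> nat, [/\ g v (s 0), forall i, i < k ->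
      h [tuple of i :: s i :: v] (s i.+1) & y = s k]) <-> exists t, Q t v k = y.+1.
  elim: k y => [|k IH] y.
    split=> [[s [gs _ ->]]|[t Qt]]; first exact/GE.
    by exists (fun=> y); split=> //; apply/GE; exists t.
  split=> [[s [gs hs ->]]|[t]] /=.
  - have /IH[t0 Qt0] : exists s' : nat -> nat, [/\ g v (s' 0), forall i, i < k ->
      h [tuple of i :: s' i :: v] (s' i.+1) & s k = s' k].
      by exists s; split=> // i ik; apply: hs; rewrite ltnW.
    have [t1 Ht1] := (HE _ _).1 (hs k (ltnSn k)).
    exists (maxn t0 t1).
    have Qt : Q (maxn t0 t1) v k = (s k).+1.
      by rewrite -Qt0; apply: Qm; rewrite ?leq_maxl// Qt0.
    rewrite /= -/(Q (maxn t0 t1) v k) Qt /= -Ht1.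
    by apply: Hm; rewrite ?leq_maxr// Ht1.
  - rewrite -/(Q t v k); case E: (Q t v k) => [|r] //= Hy.
    have /IH[s [gs hs sk]] : exists t, Q t v k = r.+1 by exists t.
    (* The sequence for [k] is cut off after [k] and continued by the new value. *)
    exists (fun i => if i <= k then s i else y); split=> //; last by rewrite ltnn.
    move=> i /ltnSE ik1; have [->|ik] : i = k \/ i < k by lia.
      by rewrite /= leqnn ltnn; apply/HE; exists t; rewrite -sk.
    by rewrite /= ltnW// ik; exact: hs.
exists (fun w : n.+2.-tuple nat => Q (thead w) [tuple of behead (behead w)] (thead [tuple of
    behead w])); split.
- apply: (@rec_ext _ (fun w : n.+2.-tuple nat => nat_rect (fun=> nat)
     (G [tuple of tnth w ord0 :: behead (behead w)])
     (fun i r => ifz r 0 (H [tuple of tnth w ord0 :: i :: r.-1 :: behead (behead w)]))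
     (tnth w (lift ord0 ord0)))).
    move=> w; rewrite /Q /thead tnth_behead.
    have -> : inord 1 = lift ord0 ord0 :> 'I_n.+2 by apply: val_inj; rewrite /= inordK.
    by [].
  apply: (rec_natrec (h := fun i r (w : n.+2.-tuple nat) =>
     ifz r 0 (H [tuple of tnth w ord0 :: i :: r.-1 :: behead (behead w)]))).
  + exact: rec_proj.
  + pose hh (i : 'I_n.+1) (w : n.+2.-tuple nat) :=
      if unlift ord0 i is Some j then tnth w (lift ord0 (lift ord0 j)) else tnth w ord0.
    apply: rec_ext (rec_comp (h := hh) rG _); last first.
      by move=> i; rewrite /hh; case: unliftP => [j|] _; exact: rec_proj.
    move=> w; congr G; apply: eq_from_tnth => i; rewrite tnth_mktuple /hh.
    case: unliftP => [j|] ->; rewrite ?tnth0 // tnthS !tnth_behead.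
    by congr tnth; apply: val_inj; have := ltn_ord j; rewrite /= !inordK// !ltnS.
  + apply: rec_ifz; [exact: rec_proj|exact: rec_const|].
    pose hh (i : 'I_n.+3) (w : n.+4.-tuple nat) :=
      if unlift ord0 i is Some j then
        if unlift ord0 j is Some l then 
          if unlift ord0 l is Some o then tnth w (lift ord0 (lift ord0 (lift ord0 (lift ord0 o))))
          else (tnth w (lift ord0 ord0)).-1
        else tnth w ord0
      else tnth w (lift ord0 (lift ord0 ord0)).
    apply: rec_ext (rec_comp (h := hh) rH _); last first.
      move=> i; rewrite /hh; case: unliftP => [j|] _; last exact: rec_proj.
      case: unliftP => [l|] _; last exact: rec_proj.
      by case: unliftP => [o|] _; [|apply: rec_pred]; exact: rec_proj.
    move=> w; congr H; apply: eq_from_tnth => i; rewrite tnth_mktuple /hh.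
    case: unliftP => [j|] ->; rewrite ?tnth0 ?tnthS; last first.
      by rewrite !tnth_behead; congr tnth; apply: val_inj; rewrite /= !inordK.
    case: unliftP => [l|] ->; rewrite ?tnth0 ?tnthS //.
    case: unliftP => [o|] ->; rewrite ?tnth0 ?tnthS // !tnth_behead.
    by congr tnth; apply: val_inj; have := ltn_ord o; rewrite /= !inordK// !ltnS.
- move=> v y; rewrite QE.
  suff E t : Q (thead [tuple of t :: v]) [tuple of behead (behead [tuple of t :: v])]
    (thead [tuple of behead [tuple of t :: v]]) = Q t [tuple of behead v] (thead v).
    by split=> -[t Ht]; exists t; rewrite -Ht E.
  congr Q; rewrite ?theadE//; first exact: val_inj.
  by congr thead; exact: val_inj.
- move=> v t t' tt'.
  have E s : Q (thead [tuple of s :: v]) [tuple of behead (behead [tuple of s :: v])]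
    (thead [tuple of behead [tuple of s :: v]]) = Q s [tuple of behead v] (thead v).
    congr Q; rewrite ?theadE//; first exact: val_inj.
    by congr thead; exact: val_inj.
  by rewrite !E; exact: Qm.
Qed.

(** Stage [t] limits both the search, to candidates below [t], and the time of each evaluation. *)
Lemma staged_min n (g : n.+1.-tuple nat -> nat -> Prop) :
  (exists G, staged g G) ->
  exists F, staged (fun (v : n.-tuple nat) y =>
       g [tuple of y :: v] 0 /\
       forall z, z < y -> exists k, g [tuple of z :: v] k.+1) F.
Proof.
move=> [G [rG GE Gm]].
(* The search over [z < k] is in state [0] if it got stuck, [1] if it goes on and
   [z.+2] once it found the zero [z]. *)
pose Q t (v : n.-tuple nat) k := nat_rect (fun=> nat) 1
  (fun z r => ifz r 0 (ifz r.-1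
     (ifz (G [tuple of t :: z :: v]) 0 (ifz (G [tuple of t :: z :: v]).-1 z.+2 1)) r)) k.
have Q1 t v k : Q t v k = 1 <->
    forall z, z < k -> exists a, G [tuple of t :: z :: v] = a.+2.
  elim: k => [|k IH] //=; rewrite -/(Q t v k); split.
  - case E : (Q t v k) IH => [|[|r]] //= IH.
    case Ez : (G _) => [|[|a]] //= _ z; rewrite ltnS leq_eqVlt => /predU1P[->|zk];
        first by exists a.
    exact: IH.1 zk.
  - move=> Hz; have /IH -> /= : forall z, z < k -> exists a, G [tuple of t :: z :: v] = a.+2.
      by move=> z zk; apply: Hz; rewrite ltnW.
    by have [a ->] := Hz k (ltnSn k).
have Q2 t v k y : Q t v k = y.+2 <-> [/\ y < k, G [tuple of t :: y :: v] = 1 &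
    forall z, z < y -> exists a, G [tuple of t :: z :: v] = a.+2].
  elim: k y => [|k IH] y; first by split=> // -[].
  have E1 := Q1 t v k; rewrite /= -/(Q t v k); split.
  - case E : (Q t v k) IH E1 => [|[|r]] //= IH E1.
      case Ez : (G _) => [|[|a]] //= [<-]; split=> //; exact: E1.1.
    by move=> [<-]; have [rk Gr Hz] := (IH r).1 erefl; split=> //; rewrite ltnW.
  - move=> [+ Gy Hz]; rewrite ltnS leq_eqVlt => /predU1P[yk|yk].
      by rewrite -yk in E1 *; rewrite E1.2//= Gy.
    by have /IH -> : [/\ y < k, G [tuple of t :: y :: v] = 1 &
       forall z, z < y -> exists a, G [tuple of t :: z :: v] = a.+2] by [].
have QE t v y : (Q t v t).-1 = y.+1 <-> Q t v t = y.+2 by case: (Q t v t) => [|[|?]];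
    split=> // -[->].
exists (fun w : n.+1.-tuple nat => (Q (thead w) [tuple of behead w] (thead w)).-1).
have Et (v : n.-tuple nat) t : Q (thead [tuple of t :: v]) [tuple of behead [tuple of t :: v]]
    (thead [tuple of t :: v]) = Q t v t.
  by congr Q; exact: val_inj.
have Qm (v : n.-tuple nat) t t' y : t <= t' -> Q t v t = y.+2 -> Q t' v t' = y.+2.
  move=> tt' /Q2[yt Gy Hz]; apply/Q2; split; first exact: leq_trans tt'.
    by rewrite -Gy; apply: Gm => //; rewrite Gy.
  by move=> z /Hz[a Ga]; exists a; rewrite -Ga; apply: Gm => //; rewrite Ga.
split.
- apply: rec_pred.
  apply: (rec_natrec (h := fun z r (w : n.+1.-tuple nat) => ifz r 0 (ifz r.-1
     (ifz (G [tuple of thead w :: z :: behead w]) 0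
        (ifz (G [tuple of thead w :: z :: behead w]).-1 z.+2 1)) r))).
  + exact: rec_proj.
  + exact: rec_const.
  + set GG := fun w : n.+3.-tuple nat => G [tuple of thead [tuple of behead (behead w)] ::
       tnth w ord0 :: behead [tuple of behead (behead w)]].
    have rGG : rec GG.
      pose hh (i : 'I_n.+2) (w : n.+3.-tuple nat) :=
        if unlift ord0 i is Some j then
          if unlift ord0 j is Some l then tnth w (lift ord0 (lift ord0 (lift ord0 l)))
          else tnth w ord0
        else tnth w (lift ord0 (lift ord0 ord0)).
      apply: rec_ext (rec_comp (h := hh) rG _); last first.
        move=> i; rewrite /hh; case: unliftP => [j|] _; last exact: rec_proj.
        by case: unliftP => [l|] _; exact: rec_proj.
      move=> w; congr G; apply: eq_from_tnth => i; rewrite tnth_mktuple /hh.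
      case: unliftP => [j|] ->; rewrite ?tnth0 ?tnthS; last first.
        by rewrite /thead !tnth_behead; congr tnth; apply: val_inj; rewrite /= !inordK.
      case: unliftP => [l|] ->; rewrite ?tnth0 ?tnthS // !tnth_behead.
      by congr tnth; apply: val_inj; have := ltn_ord l; rewrite /= !inordK// !ltnS.
    apply: rec_ifz; [exact: rec_proj|exact: rec_const|].
    apply: rec_ifz; [exact/rec_pred/rec_proj| |exact: rec_proj].
    apply: rec_ifz; [exact: rGG|exact: rec_const|].
    apply: rec_ifz; [exact/rec_pred/rGG|exact/rec_succ/rec_succ/rec_proj|exact: rec_const].
- move=> v y; split=> [[/GE[t0 Gt0] gz]|[t]].
  + have /choice[tz Htz] : forall z, exists t, z < y -> exists k, G [tuple of t :: z :: v] = k.+2.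
      move=> z; have [/gz[k /GE[t Gt]]|_] := boolP (z < y); last by exists 0.
      by exists t => _; exists k.
    (* The stage has to exceed [y] as well, since only candidates below [t] are searched. *)
    pose t := maxn (maxn t0 y.+1) (\max_(z < y) tz z).
    have tt0 : t0 <= t by rewrite /t !leq_max leqnn.
    exists t; rewrite Et; apply/QE/Q2; split.
    * by rewrite /t !leq_max leqnn orbT.
    * by rewrite -Gt0; apply: Gm => //; rewrite Gt0.
    * move=> z zy; have [a Ga] := Htz z zy; exists a; rewrite -Ga; apply: Gm.
        by rewrite /t leq_max (leq_bigmax_cond (P := xpredT) (F := fun z : 'I_y => tz z)
            (Ordinal zy)) ?orbT.
      by rewrite Ga.
  + rewrite Et => /QE/Q2[_ Gy Hz]; split; first by apply/GE; exists t.
    by move=> z /Hz[a Ga]; exists a; apply/GE; exists t.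
- move=> v t t' tt'; rewrite !Et.
  case E : (Q t v t) => [|[|y]] //= _; by rewrite (Qm v t t' y).
Qed.

Lemma staged_ex n (f : n.-tuple nat -> nat -> Prop) :
  partial_recursive f -> exists F, staged f F.
Proof.
elim=> {n f} [n||n i|m n g h _ IHg _ IHh|n g h _ IHg _ IHh|n g _ IHg].
- exact/staged_total/pr_zero.
- exact/staged_total/pr_succ.
- exact/staged_total/pr_proj.
- exact: staged_comp.
- exact: staged_rec.
- exact: staged_min.
Qed.

(** Both values are present at the later of their two stages. *)
Lemma pr_functional n (f : n.-tuple nat -> nat -> Prop) v y z :
  partial_recursive f -> f v y -> f v z -> y = z.
Proof.
move=> /staged_ex[F [_ FE Fm]] /FE[t Ft] /FE[t' Ft'].
suff : y.+1 = z.+1 by case.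
have Ht := Fm v t (maxn t t') (leq_maxl _ _); have Ht' := Fm v t' (maxn t t') (leq_maxr _ _).
by rewrite -Ft -Ft' -Ht ?Ft// -Ht' ?Ft'.
Qed.

(** * Computable functions on data types *)

Definition Rec (g : nat -> nat) := rec (fun v : 1.-tuple nat => g (thead v)).

Lemma Rec_rec n (g : nat -> nat) (f : n.-tuple nat -> nat) :
  Rec g -> rec f -> rec (fun v => g (f v)).
Proof. exact: rec_comp1. Qed.

Lemma Rec_comp g f : Rec g -> Rec f -> Rec (fun a => g (f a)).
Proof. exact: rec_comp1. Qed.

Lemma Rec_id : Rec id. Proof. exact: rec_proj. Qed.

Lemma Rec_natrec N g h : Rec N -> Rec g ->
  rec (fun w : 3.-tuple nat => h (tnth w (inord 0)) (tnth w (inord 1)) (tnth w (inord 2))) ->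
  Rec (fun a => nat_rect (fun=> nat) (g a) (fun i r => h i r a) (N a)).
Proof.
move=> rN rg rh; apply: (rec_natrec (h := fun i r v => h i r (thead v)) rN rg).
apply: rec_ext rh => w; rewrite /thead !tnth_behead; congr h; congr tnth;
  by apply: val_inj; rewrite /= !inordK.
Qed.

Definition cpair (a b : nat) := (a + b) * (a + b) + b.
(** The integer square root. A code [cpair a b] lies between the squares of [a + b] and [a + b + 1],
    so its root is [a + b]. *)
Definition csqrt n := nat_rect (fun=> nat) 0 (fun _ r => ifz (r.+1 * r.+1 - n) r.+1 r) n.
Definition csnd n := n - csqrt n * csqrt n.
Definition cfst n := csqrt n - csnd n.

Lemma csqrtP n : csqrt n * csqrt n <= n < (csqrt n).+1 * (csqrt n).+1.
Proof.
(* After [k] rounds the candidate root has either grown in every round or can grow no more. For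
   [k = n] the first case gives the upper bound too. *)
rewrite /csqrt; suff : forall k, let r := nat_rect (fun=> nat) 0
    (fun _ r => ifz (r.+1 * r.+1 - n) r.+1 r) k in
  r * r <= n /\ (r = k \/ n < r.+1 * r.+1).
  by move=> /(_ n) /=; set r := nat_rect _ _ _ _; nia.
elim=> [|k] /=; first by split; [|left].
set r := nat_rect _ _ _ _; case E : (_ - n) => [|a] /= [].
  by move=> _ []; lia.
by lia.
Qed.

Lemma csqrtE a b : csqrt (cpair a b) = a + b.
Proof. have := csqrtP (cpair a b); rewrite /cpair; nia. Qed.

Lemma cpairK1 a b : cfst (cpair a b) = a.
Proof. rewrite /cfst /csnd csqrtE /cpair; lia. Qed.

Lemma cpairK2 a b : csnd (cpair a b) = b.
Proof. rewrite /csnd csqrtE /cpair; lia. Qed.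

Lemma rec_cpair n (f g : n.-tuple nat -> nat) :
  rec f -> rec g -> rec (fun v => cpair (f v) (g v)).
Proof. by move=> rf rg; apply: rec_add => //; apply: rec_mul; exact: rec_add. Qed.

Lemma Rec_csqrt : Rec csqrt.
Proof.
apply: (Rec_natrec (N := id) (g := fun=> 0)
  (h := fun _ r n => ifz (r.+1 * r.+1 - n) r.+1 r)); [exact: Rec_id|exact: rec_const|].
apply: rec_ifz; last exact: rec_proj.
  by apply: rec_sub; [apply: rec_mul; apply: rec_succ|]; exact: rec_proj.
by apply: rec_succ; exact: rec_proj.
Qed.

Lemma Rec_csnd : Rec csnd.
Proof. by apply: rec_sub Rec_id _; apply: rec_mul; exact: Rec_csqrt. Qed.

Lemma Rec_cfst : Rec cfst.
Proof. exact: rec_sub Rec_csqrt Rec_csnd. Qed.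

Class codable (T : Type) := encode : T -> nat.

Instance codable_nat : codable nat := id.
Instance codable_bool : codable bool := nat_of_bool.
Instance codable_prod A B {eA : codable A} {eB : codable B} : codable (A * B) :=
  fun p => cpair (eA p.1) (eB p.2).
Instance codable_seq A {eA : codable A} : codable (seq A) :=
  fix enc s := if s is x :: s' then (cpair (eA x) (enc s')).+1 else 0.

(** The tracking function [g] is constrained on codes only, so that [codable] can do with an
    encoding alone. *)
Inductive Comp A B {eA : codable A} {eB : codable B} (f : A -> B) : Prop :=
  CompI g of Rec g & forall a, g (encode a) = encode (f a).

Section Closure.
Context {A : Type} {eA : codable A}.

Lemma comp_ext B {eB : codable B} (f g : A -> B) : f =1 g -> Comp f -> Comp g.
Proof. by move=> fg [h rh hE]; exists h => // a; rewrite hE fg. Qed.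

Lemma comp_id : Comp (fun a : A => a).
Proof. by exists id => //; exact: Rec_id. Qed.

Lemma comp_const B {eB : codable B} (b : B) : Comp (fun _ : A => b).
Proof. by exists (fun=> encode b) => //; exact: rec_const. Qed.

Lemma comp_comp B C {eB : codable B} {eC : codable C} (f : B -> C) (g : A -> B) :
  Comp f -> Comp g -> Comp (fun a => f (g a)).
Proof.
move=> [f' rf fE] [g' rg gE]; exists (fun a => f' (g' a)); first exact: Rec_comp.
by move=> a; rewrite gE fE.
Qed.

Lemma comp_pair B C {eB : codable B} {eC : codable C} (f : A -> B) (g : A -> C) :
  Comp f -> Comp g -> Comp (fun a => (f a, g a)).
Proof.
move=> [f' rf fE] [g' rg gE]; exists (fun a => cpair (f' a) (g' a)).
  exact: rec_cpair.
by move=> a; rewrite gE fE.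
Qed.

Lemma comp_fst B C {eB : codable B} {eC : codable C} (f : A -> B * C) :
  Comp f -> Comp (fun a => (f a).1).
Proof.
apply: comp_comp; exists cfst; first exact: Rec_cfst.
by move=> [b c]; exact: cpairK1.
Qed.

Lemma comp_snd B C {eB : codable B} {eC : codable C} (f : A -> B * C) :
  Comp f -> Comp (fun a => (f a).2).
Proof.
apply: comp_comp; exists csnd; first exact: Rec_csnd.
by move=> [b c]; exact: cpairK2.
Qed.

Lemma comp_encode B {eB : codable B} (f : A -> B) : Comp f -> Comp (fun a => encode (f a)).
Proof. by move=> [g rg gE]; exists g. Qed.

Lemma comp_natrec B {eB : codable B} (N : A -> nat) (g : A -> B) (h : A -> nat -> B -> B) :
  Comp N -> Comp g -> Comp (fun p : A * nat * B => h p.1.1 p.1.2 p.2) ->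
  Comp (fun a => nat_rect (fun=> B) (g a) (h a) (N a)).
Proof.
move=> [N' rN NE] [g' rg gE] [h' rh hE].
exists (fun a => nat_rect (fun=> nat) (g' a) (fun i r => h' (cpair (cpair a i) r)) (N' a)).
  apply: (Rec_natrec (h := fun i r a => h' (cpair (cpair a i) r))) => //.
  apply: (Rec_rec rh); apply: rec_cpair; last exact: rec_proj.
  by apply: rec_cpair; exact: rec_proj.
move=> a; rewrite NE gE {1}/encode /codable_nat /=.
elim: (N a) => [|k IH] //=; rewrite IH.
exact: (hE (a, k, nat_rect (fun=> B) (g a) (h a) k)).
Qed.

Lemma comp_if B {eB : codable B} (c : A -> bool) (f g : A -> B) :
  Comp c -> Comp f -> Comp g -> Comp (fun a => if c a then f a else g a).
Proof.
move=> [c' rc cE] [f' rf fE] [g' rg gE]; exists (fun a => ifz (c' a) (g' a) (f' a)).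
  exact: rec_ifz.
by move=> a; rewrite cE gE fE; case: (c a).
Qed.

Lemma comp_nil B {eB : codable B} : Comp (fun _ : A => [::] : seq B).
Proof. exact: comp_const. Qed.

Lemma comp_cons B {eB : codable B} (f : A -> B) (g : A -> seq B) :
  Comp f -> Comp g -> Comp (fun a => f a :: g a).
Proof.
move=> [f' rf fE] [g' rg gE]; exists (fun a => (cpair (f' a) (g' a)).+1).
  by apply: rec_succ; apply: rec_cpair.
by move=> a; rewrite gE fE.
Qed.

Lemma comp_case_seq B C {eB : codable B} {eC : codable C} (s : A -> seq B) (f : A -> C)
    (g : A -> B -> seq B -> C) :
  Comp s -> Comp f -> Comp (fun p : A * B * seq B => g p.1.1 p.1.2 p.2) ->
  Comp (fun a => if s a is x :: s' then g a x s' else f a).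
Proof.
move=> [s' rs sE] [f' rf fE] [g' rg gE].
exists (fun a => ifz (s' a) (f' a) (g' (cpair (cpair a (cfst (s' a).-1)) (csnd (s' a).-1)))).
  apply: rec_ifz => //; apply: Rec_rec rg _; apply: rec_cpair.
    apply: rec_cpair; first exact: Rec_id.
    by apply: Rec_rec Rec_cfst _; apply: rec_pred.
  by apply: Rec_rec Rec_csnd _; apply: rec_pred.
move=> a; rewrite sE fE; case: (s a) => [|x s0] //=.
by rewrite cpairK1 cpairK2; exact: (gE (a, x, s0)).
Qed.

Lemma comp_succ (f : A -> nat) : Comp f -> Comp (fun a => (f a).+1).
Proof. by move=> [f' rf fE]; exists (fun a => (f' a).+1); [exact: rec_succ|move=> a;
    rewrite fE]. Qed.

Lemma comp_pred (f : A -> nat) : Comp f -> Comp (fun a => (f a).-1).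
Proof. by move=> [f' rf fE]; exists (fun a => (f' a).-1); [exact: rec_pred|move=> a;
    rewrite fE]. Qed.

Section Nat.
Context (f g : A -> nat) (cf : Comp f) (cg : Comp g).

Lemma comp_add : Comp (fun a => f a + g a).
Proof.
case: cf cg => [f' rf fE] [g' rg gE]; exists (fun a => f' a + g' a).
  exact: rec_add.
by move=> a; rewrite fE gE.
Qed.

Lemma comp_sub : Comp (fun a => f a - g a).
Proof.
case: cf cg => [f' rf fE] [g' rg gE]; exists (fun a => f' a - g' a).
  exact: rec_sub.
by move=> a; rewrite fE gE.
Qed.

Lemma comp_mul : Comp (fun a => f a * g a).
Proof.
case: cf cg => [f' rf fE] [g' rg gE]; exists (fun a => f' a * g' a).
  exact: rec_mul.
by move=> a; rewrite fE gE.
Qed.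

Lemma comp_leq : Comp (fun a => f a <= g a).
Proof.
case: comp_sub => h rh hE; exists (fun a => ifz (h a) 1 0).
  by apply: rec_ifz => //; exact: rec_const.
by move=> a; rewrite hE /leq /encode; case: (_ - _).
Qed.
End Nat.

Lemma comp_and (f g : A -> bool) : Comp f -> Comp g -> Comp (fun a => f a && g a).
Proof.
move=> cf cg; apply: comp_ext (comp_if cf cg (comp_const false)) => a.
by case: (f a).
Qed.

Lemma comp_or (f g : A -> bool) : Comp f -> Comp g -> Comp (fun a => f a || g a).
Proof.
move=> cf cg; apply: comp_ext (comp_if cf (comp_const true) cg) => a.
by case: (f a).
Qed.

Lemma comp_neg (f : A -> bool) : Comp f -> Comp (fun a => ~~ f a).
Proof.
move=> cf; apply: comp_ext (comp_if cf (comp_const false) (comp_const true)) => a.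
by case: (f a).
Qed.

Lemma comp_eqn (f g : A -> nat) : Comp f -> Comp g -> Comp (fun a => f a == g a).
Proof.
move=> cf cg; apply: comp_ext (comp_and (comp_leq cf cg) (comp_leq cg cf)) => a.
by rewrite eqn_leq.
Qed.
End Closure.

Section Compound.
Context {A : Type} {eA : codable A}.

Lemma comp_expn (f g : A -> nat) : Comp f -> Comp g -> Comp (fun a => f a ^ g a).
Proof.
move=> cf cg; apply: comp_ext (comp_natrec (h := fun a _ r => f a * r) cg (comp_const 1) _).
  by move=> a; elim: (g a) => [|k /= ->]; rewrite ?expn0 ?expnS.
apply: comp_mul; last exact/comp_snd/comp_id.
exact/(comp_comp cf)/comp_fst/comp_fst/comp_id.
Qed.

(** Quotient and remainder are counted up together. For a zero divisor the remainder is never reset,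
    in agreement with [divn0] and [modn0]. *)
Lemma comp_divmod (f g : A -> nat) : Comp f -> Comp g ->
  Comp (fun a => (f a %/ g a, f a %% g a)).
Proof.
move=> cf cg; apply: comp_ext (comp_natrec (N := f) (g := fun=> (0, 0))
  (h := fun a _ r => if r.2.+1 == g a then (r.1.+1, 0) else (r.1, r.2.+1)) cf _ _).
- move=> a; case: (posnP (g a)) => [->|g0].
    rewrite divn0 modn0; elim: (f a) => [|k IH]//=; by rewrite IH.
  elim: (f a) => [|k IH] /=; first by rewrite div0n mod0n.
  rewrite IH /= -/(k.+1).
  have [E|E] := eqVneq.
    have -> : k.+1 = (k %/ g a).+1 * g a by rewrite mulSn {1}(divn_eq k (g a)) -addnS E addnC.
    by rewrite mulnK// modnMl.
  have lt : (k %% g a).+1 < g a by rewrite ltn_neqAle E ltn_mod.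
  have -> : k.+1 = k %/ g a * g a + (k %% g a).+1 by rewrite {1}(divn_eq k (g a)) addnS.
  by rewrite divnMDl// modnMDl (divn_small lt) (modn_small lt) addn0.
- exact: comp_const.
- apply: comp_if.
  + apply: comp_eqn; first exact/comp_succ/comp_snd/comp_snd/comp_id.
    exact/(comp_comp cg)/comp_fst/comp_fst/comp_id.
  + apply: comp_pair; last exact: comp_const.
    exact/comp_succ/comp_fst/comp_snd/comp_id.
  + apply: comp_pair; first exact/comp_fst/comp_snd/comp_id.
    exact/comp_succ/comp_snd/comp_snd/comp_id.
Qed.

Lemma comp_divn (f g : A -> nat) : Comp f -> Comp g -> Comp (fun a => f a %/ g a).
Proof. by move=> cf cg; exact: (comp_fst (comp_divmod cf cg)). Qed.

Lemma comp_modn (f g : A -> nat) : Comp f -> Comp g -> Comp (fun a => f a %% g a).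
Proof. by move=> cf cg; exact: (comp_snd (comp_divmod cf cg)). Qed.

(** This makes the code of a list an iteration bound for loops over the list. *)
Lemma size_encode B {eB : codable B} (s : seq B) : size s <= encode s.
Proof.
elim: s => //= x s IH; rewrite /encode /= -/(encode s) ltnS /cpair.
by apply: leq_trans (leq_addl _ _).
Qed.

(** The list is consumed in [encode (s a)] rounds of primitive recursion; once it is empty, further
    rounds change nothing. *)
Lemma comp_foldl B C {eB : codable B} {eC : codable C} (s : A -> seq B) (c : A -> C)
    (f : A -> C -> B -> C) :
  Comp s -> Comp c -> Comp (fun p : A * C * B => f p.1.1 p.1.2 p.2) ->
  Comp (fun a => foldl (f a) (c a) (s a)).
Proof.
move=> cs cc cf.
apply: comp_ext (comp_snd (comp_natrec (N := fun a => encode (s a))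
   (g := fun a => (s a, c a))
   (h := fun a _ r => if r.1 is x :: s' then (s', f a r.2 x) else ([::], r.2)) _ _ _)).
- move=> a.
  have H k s0 c0 : size s0 <= k -> nat_rect (fun=> seq B * C)%type (s0, c0)
    (fun (_ : nat) r => if r.1 is x :: s' then (s', f a r.2 x) else ([::], r.2)) k =
    ([::], foldl (f a) c0 s0).
    pose st (r : seq B * C) := if r.1 is x :: s' then (s', f a r.2 x) else ([::], r.2).
    rewrite -/(fun (_ : nat) r => st r) => H; rewrite (_ : nat_rect _ _ _ _ = iter k st (s0, c0)).
      by elim: k s0 c0 H => [|k IH] [|x s0] c0 //= H; rewrite -iterS iterSr /st /= IH.
    by elim: (k) => //= m ->.
  by rewrite H ?size_encode.
- exact: comp_encode.
- exact: comp_pair.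
- apply: (comp_case_seq (s := fun p : A * nat * (seq B * C) => p.2.1)
     (g := fun p x s' => (s', f p.1.1 p.2.2 x))).
  + exact/comp_fst/comp_snd/comp_id.
  + by apply: comp_pair; [exact: comp_const|exact/comp_snd/comp_snd/comp_id].
  + apply: comp_pair; first exact/comp_snd/comp_id.
    apply: (comp_comp (g := fun p : A * nat * (seq B * C) * B * seq B =>
      (p.1.1.1.1, p.1.1.2.2, p.1.2)) cf).
    apply: comp_pair; last exact/comp_snd/comp_fst/comp_id.
    apply: comp_pair; first exact/comp_fst/comp_fst/comp_fst/comp_fst/comp_id.
    exact/comp_snd/comp_snd/comp_fst/comp_fst/comp_id.
Qed.

End Compound.

(** * Automation for computability goals *)

Ltac comp_eta := cbv beta; lazymatch goal with
  | |- Comp (fun _ => _) => idtac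
  | |- @Comp ?A _ _ _ ?f => change (Comp (fun a : A => f a))
  end.

Ltac comp_base := lazymatch goal with
  | |- Comp (fun a => a) => exact: comp_id
  | |- Comp (fun _ => ?b) => exact: comp_const
  | |- Comp (fun a => (@?f a).1) => refine (comp_fst _)
  | |- Comp (fun a => (@?f a).2) => refine (comp_snd _)
  | |- Comp (fun a => (@?f a, @?g a)) => refine (comp_pair _ _)
  | |- Comp (fun a => @?f a :: @?g a) => refine (comp_cons _ _)
  | |- Comp (fun a => if _ then _ else _) => refine (comp_if _ _ _)
  | |- Comp (fun a => (@?f a).+1) => refine (comp_succ _)
  | |- Comp (fun a => (@?f a).-1) => refine (comp_pred _)
  | |- Comp (fun a => @?f a + @?g a) => refine (comp_add _ _)
  | |- Comp (fun a => @?f a - @?g a) => refine (comp_sub _ _)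
  | |- Comp (fun a => @?f a * @?g a) => refine (comp_mul _ _)
  | |- Comp (fun a => @?f a ^ @?g a) => refine (comp_expn _ _)
  | |- Comp (fun a => @?f a %/ @?g a) => refine (comp_divn _ _)
  | |- Comp (fun a => @?f a %% @?g a) => refine (comp_modn _ _)
  | |- Comp (fun a => @?f a <= @?g a) => refine (comp_leq _ _)
  | |- Comp (fun a => @?f a && @?g a) => refine (comp_and _ _)
  | |- Comp (fun a => @?f a || @?g a) => refine (comp_or _ _)
  | |- Comp (fun a => ~~ @?f a) => refine (comp_neg _)
  | |- Comp (fun a => @?f a == @?g a) => refine (comp_eqn _ _)
  | |- Comp (fun a => foldl _ _ _) => refine (comp_foldl _ _ _)
  | |- Comp (fun a => nat_rect _ _ _ _) => refine (comp_natrec _ _ _)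
  end.

Ltac comp1 := comp_eta; first [comp_base | assumption].
Ltac comp := repeat comp1.

(** * Computability of list operations *)

Section Lists.
Context {A : Type} {eA : codable A}.

Lemma comp_rev B {eB : codable B} (s : A -> seq B) : Comp s -> Comp (fun a => rev (s a)).
Proof.
move=> cs; apply: (@comp_ext _ _ _ _ (fun a => foldl (fun r x => x :: r) [::] (s a))).
  by move=> a; rewrite -[s a in LHS]revK foldl_rev; elim: (rev (s a)) => //= x r ->.
by comp.
Qed.

Lemma comp_foldr B C {eB : codable B} {eC : codable C} (s : A -> seq B) (c : A -> C)
    (f : A -> B -> C -> C) :
  Comp s -> Comp c -> Comp (fun p : A * B * C => f p.1.1 p.1.2 p.2) ->
  Comp (fun a => foldr (f a) (c a) (s a)).
Proof.
move=> cs cc cf.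
apply: comp_ext (comp_foldl (f := fun a r x => f a x r) (comp_rev cs) cc _).
  by move=> a; rewrite foldl_rev.
by apply: (comp_comp (g := fun p : A * C * B => (p.1.1, p.2, p.1.2)) cf); comp.
Qed.

Lemma comp_map B C {eB : codable B} {eC : codable C} (s : A -> seq B) (f : A -> B -> C) :
  Comp s -> Comp (fun p : A * B => f p.1 p.2) -> Comp (fun a => map (f a) (s a)).
Proof.
move=> cs cf; apply: comp_ext (comp_foldr (f := fun a x r => f a x :: r) cs (comp_nil) _).
  by move=> a; elim: (s a) => //= x s' ->.
by comp; apply: (comp_comp (g := fun p : A * B * seq C => p.1) cf); comp.
Qed.

Lemma comp_filter B {eB : codable B} (s : A -> seq B) (f : A -> B -> bool) :
  Comp s -> Comp (fun p : A * B => f p.1 p.2) -> Comp (fun a => seq.filter (f a) (s a)).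
Proof.
move=> cs cf; apply: comp_ext (comp_foldr (f := fun a x r => if f a x then x :: r else r) cs
    (comp_nil) _).
  by move=> a; elim: (s a) => //= x s' ->.
by comp; apply: (comp_comp (g := fun p : A * B * seq B => p.1) cf); comp.
Qed.

Lemma comp_all B {eB : codable B} (s : A -> seq B) (f : A -> B -> bool) :
  Comp s -> Comp (fun p : A * B => f p.1 p.2) -> Comp (fun a => all (f a) (s a)).
Proof.
move=> cs cf; apply: comp_ext (comp_foldr (f := fun a x r => f a x && r) cs (comp_const true) _).
  by move=> a; elim: (s a) => //= x s' ->.
by comp; apply: (comp_comp (g := fun p : A * B * bool => p.1) cf); comp.
Qed.

Lemma comp_has B {eB : codable B} (s : A -> seq B) (f : A -> B -> bool) :
  Comp s -> Comp (fun p : A * B => f p.1 p.2) -> Comp (fun a => has (f a) (s a)).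
Proof.
move=> cs cf; apply: comp_ext (comp_foldr (f := fun a x r => f a x || r) cs (comp_const false) _).
  by move=> a; elim: (s a) => //= x s' ->.
by comp; apply: (comp_comp (g := fun p : A * B * bool => p.1) cf); comp.
Qed.

Lemma comp_find B {eB : codable B} (s : A -> seq B) (f : A -> B -> bool) :
  Comp s -> Comp (fun p : A * B => f p.1 p.2) -> Comp (fun a => find (f a) (s a)).
Proof.
move=> cs cf; apply: comp_ext (comp_foldr (f := fun a x r => if f a x then 0 else r.+1) cs
    (comp_const 0) _).
  by move=> a; elim: (s a) => //= x s' ->.
by comp; apply: (comp_comp (g := fun p : A * B * nat => p.1) cf); comp.
Qed.

Lemma comp_mem (x : A -> nat) (s : A -> seq nat) :
  Comp x -> Comp s -> Comp (fun a => x a \in s a).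
Proof.
move=> cx cs; apply: comp_ext (comp_has (f := fun a y => y == x a) cs _).
  by move=> a; rewrite -has_pred1.
by comp; apply: (comp_comp cx); comp.
Qed.

Lemma comp_size B {eB : codable B} (s : A -> seq B) : Comp s -> Comp (fun a => size (s a)).
Proof.
move=> cs; apply: comp_ext (comp_foldr (f := fun a x r => r.+1) cs (comp_const 0) _).
  by move=> a; elim: (s a) => //= x s' ->.
by comp.
Qed.

Lemma comp_cat B {eB : codable B} (s t : A -> seq B) :
  Comp s -> Comp t -> Comp (fun a => s a ++ t a).
Proof.
move=> cs ct; apply: comp_ext (comp_foldr (f := fun a x r => x :: r) cs ct _).
  by move=> a; elim: (s a) => //= x s' ->.
by comp.
Qed.

Lemma comp_rcons B {eB : codable B} (s : A -> seq B) (x : A -> B) :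
  Comp s -> Comp x -> Comp (fun a => rcons (s a) (x a)).
Proof.
move=> cs cx; apply: comp_ext (comp_cat cs (comp_cons cx comp_nil)).
by move=> a; rewrite cats1.
Qed.

Lemma comp_nseq B {eB : codable B} (n : A -> nat) (x : A -> B) :
  Comp n -> Comp x -> Comp (fun a => nseq (n a) (x a)).
Proof.
move=> cn cx; apply: comp_ext (comp_natrec (h := fun a _ r => x a :: r) cn (comp_nil) _).
  by move=> a; elim: (n a) => //= k ->.
by comp; apply: (comp_comp cx); comp.
Qed.

Lemma comp_iota (m n : A -> nat) :
  Comp m -> Comp n -> Comp (fun a => iota (m a) (n a)).
Proof.
move=> cm cn; apply: comp_ext (comp_rev (comp_natrec (h := fun a i r => m a + i :: r) cn
    (comp_nil) _)).
  move=> a; rewrite -[RHS]revK; congr rev.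
  by elim: (n a) => // k IH; rewrite -[in RHS]addn1 iotaD rev_cat /= IH.
by comp; apply: (comp_comp cm); comp.
Qed.

Lemma comp_behead B {eB : codable B} (s : A -> seq B) : Comp s -> Comp (fun a => behead (s a)).
Proof.
move=> cs; apply: comp_ext (comp_case_seq (g := fun a x s' => s') cs comp_nil _).
  by move=> a; case: (s a).
by comp.
Qed.

Lemma comp_head B {eB : codable B} (x0 : B) (s : A -> seq B) :
  Comp s -> Comp (fun a => head x0 (s a)).
Proof.
move=> cs; apply: comp_ext (comp_case_seq (g := fun a x s' => x) cs (comp_const x0) _).
  by move=> a; case: (s a).
by comp.
Qed.
End Lists.

Section Lists2.
Context {A : Type} {eA : codable A}.

Lemma comp_drop B {eB : codable B} (n : A -> nat) (s : A -> seq B) :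
  Comp n -> Comp s -> Comp (fun a => drop (n a) (s a)).
Proof.
move=> cn cs; apply: comp_ext (comp_natrec (h := fun a _ r => behead r) cn cs _).
  move=> a; elim: (n a) => [|k /= ->]; first by rewrite drop0.
  by rewrite -drop1 drop_drop.
by apply: comp_behead; comp.
Qed.

Lemma comp_nth B {eB : codable B} (x0 : B) (s : A -> seq B) (n : A -> nat) :
  Comp s -> Comp n -> Comp (fun a => nth x0 (s a) (n a)).
Proof.
move=> cs cn; apply: comp_ext (comp_head x0 (comp_drop cn cs)) => a.
by rewrite -nth0 nth_drop addn0.
Qed.

Lemma comp_mkseq B {eB : codable B} (f : A -> nat -> B) (n : A -> nat) :
  Comp (fun p : A * nat => f p.1 p.2) -> Comp n -> Comp (fun a => mkseq (f a) (n a)).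
Proof. by move=> cf cn; apply: comp_map cf; apply: comp_iota => //; comp. Qed.

Lemma comp_flatten B {eB : codable B} (s : A -> seq (seq B)) :
  Comp s -> Comp (fun a => flatten (s a)).
Proof.
move=> cs; apply: (comp_foldr (f := fun a x r => x ++ r)) => //; first exact: comp_nil.
by apply: comp_cat; comp.
Qed.
End Lists2.

Ltac comp_list := lazymatch goal with
  | |- Comp (fun a => foldr _ _ _) => refine (comp_foldr _ _ _)
  | |- Comp (fun a => map _ _) => refine (comp_map _ _)
  | |- Comp (fun a => seq.filter _ _) => refine (comp_filter _ _)
  | |- Comp (fun a => all _ _) => refine (comp_all _ _)
  | |- Comp (fun a => has _ _) => refine (comp_has _ _)
  | |- Comp (fun a => find _ _) => refine (comp_find _ _)
  | |- Comp (fun a => _ \in _) => refine (comp_mem _ _)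
  | |- Comp (fun a => size _) => refine (comp_size _)
  | |- Comp (fun a => _ ++ _) => refine (comp_cat _ _)
  | |- Comp (fun a => rcons _ _) => refine (comp_rcons _ _)
  | |- Comp (fun a => nseq _ _) => refine (comp_nseq _ _)
  | |- Comp (fun a => iota _ _) => refine (comp_iota _ _)
  | |- Comp (fun a => head _ _) => refine (comp_head _ _)
  | |- Comp (fun a => drop _ _) => refine (comp_drop _ _)
  | |- Comp (fun a => nth _ _ _) => refine (comp_nth _ _ _)
  | |- Comp (fun a => mkseq _ _) => refine (comp_mkseq _ _)
  | |- Comp (fun a => flatten _) => refine (comp_flatten _)
  end.

(** A hook for the rules of functions defined later. *)
Ltac comp_user := fail.
Ltac comp1 ::= comp_eta; first [comp_base | comp_list | assumption | comp_user].

(* Strings are handled through their numbers; [bits] recovers the string. *)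
Definition bits (x : nat) : bitstring :=
  (nat_rect (fun=> nat * seq bool)%type (x, [::])
    (fun _ r => if r.1 == 0 then r
                else (r.1.-1 %/ 2, (r.1.-1 %% 2 == 1) :: r.2)) x).2.

Lemma nat_of_rcons s b : nat_of_bitstring (rcons s b) = (nat_of_bitstring s).*2.+1 + b.
Proof. by rewrite /nat_of_bitstring -cats1 foldl_cat. Qed.

Lemma size_nat_of s : size s <= nat_of_bitstring s.
Proof. elim/last_ind: s => // s b; rewrite size_rcons nat_of_rcons; lia. Qed.

Lemma bits_nat s : bits (nat_of_bitstring s) = s.
Proof.
rewrite /bits; move: (size_nat_of s); move: {1 3}(nat_of_bitstring s) => k.
set st := fun (_ : nat) r => if _ then _ else _.
(* An accumulator is added for the induction; rounds left over after the last bit are idle. *)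
suff H r : size s <= k -> nat_rect (fun=> nat * seq bool)%type (nat_of_bitstring s, r) st k =
    (0, s ++ r).
  by move=> /H ->; rewrite cats0.
have E k' z : nat_rect (fun=> nat * seq bool)%type z st k' = iter k' (st 0) z.
  by elim: k' => //= k' ->.
rewrite E; elim/last_ind: s k r => [|s b IH] k r.
  by move=> _; elim: k => //= k ->.
rewrite size_rcons; case: k => // k /IH H.
rewrite iterSr {2}/st nat_of_rcons /= -cats1 -catA /= -H; congr iter.
congr (_, _ :: _).
  by rewrite divn2; lia.
by rewrite modn2; case: b; lia.
Qed.

Lemma nat_bits x : nat_of_bitstring (bits x) = x.
Proof.
suff [s <-] : exists s, nat_of_bitstring s = x by rewrite bits_nat.
elim/ltn_ind: x => -[|x] IH; first by exists [::].
have [s sE] := IH x./2 ltac:(lia); exists (rcons s (odd x)).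
by rewrite nat_of_rcons sE; lia.
Qed.

Lemma bits_inj : injective bits.
Proof. exact: can_inj nat_bits. Qed.

(** [(nat_of_bitstring s).+1] has the binary expansion [1s]. Hence the strings of length [n] have
    the numbers from [2 ^ n - 1] to [2 ^ n.+1 - 2]. *)
Lemma nat_of_size s : 2 ^ size s <= (nat_of_bitstring s).+1 < 2 ^ (size s).+1.
Proof.
elim/last_ind: s => // s b; rewrite size_rcons nat_of_rcons !expnS.
by case: b; lia.
Qed.

(* The automaton reading a listing: its state is (whether the next bits belong to an
   item, number of bits of the item to come, the part of the item read so far, the items
   read before). *)
Definition parse_step (r : bool * nat * nat * seq nat) (b : bool) :=
  if r.1.1.1 then
    (if r.1.1.2 == 1 then (false, 0, 0, rcons r.2 (r.1.2 * 2 + 1 + (if b then 1 else 0)))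
     else (true, r.1.1.2.-1, r.1.2 * 2 + 1 + (if b then 1 else 0), r.2))
  else if b then (false, r.1.1.2.+1, 0, r.2)
  else if r.1.1.2 == 0 then (false, 0, 0, rcons r.2 0)
  else (true, r.1.1.2, 0, r.2).
Definition parse (y : nat) : seq nat :=
  (foldl parse_step (false, 0, 0, [::]) (bits y)).2.

Lemma parse_self_delimiting x acc :
  foldl parse_step (false, 0, 0, acc) (self_delimiting x) =
  (false, 0, 0, rcons acc (nat_of_bitstring x)).
Proof.
rewrite /self_delimiting foldl_cat.
have -> n m : foldl parse_step (false, m, 0, acc) (nseq n true) = (false, m + n, 0, acc).
  by elim: n m => [|n IH] m /=; rewrite ?addn0// addnS -addSn -IH.
(* The empty string is emitted at the delimiter already, without entering the reading mode. *)
case: (posnP (size x)) => [/size0nil -> //|x0].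
rewrite add0n /= {2}/parse_step /= (gtn_eqF x0).
have H (y : bitstring) n : 0 < size y -> foldl parse_step (true, size y, n, acc) y =
    (false, 0, 0, rcons acc (foldl (fun n (b : bool) => n.*2.+1 + b) n y)).
  elim: y n => // b [|b' y] IH n _.
    by rewrite /= /parse_step /=; case: b; congr (_, rcons _ _); lia.
  have E : parse_step (true, size [:: b, b' & y], n, acc) b =
      (true, size (b' :: y), n.*2.+1 + b, acc).
    by rewrite /parse_step /=; case: b; congr (_, _, _); lia.
  transitivity (foldl parse_step (parse_step (true, size [:: b, b' & y], n, acc) b) (b' :: y))
      => //.
  by rewrite E IH.
exact: H.
Qed.

Lemma parse_listing s : parse (nat_of_bitstring (listing s)) = map nat_of_bitstring s.
Proof.
rewrite /parse bits_nat /listing -[RHS]cat0s; move: [::] => acc.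
elim: s acc => [|x s IH] acc /=; first by rewrite cats0.
by rewrite foldl_cat parse_self_delimiting IH cat_rcons.
Qed.

Section Strings.
Context {A : Type} {eA : codable A}.

Lemma comp_bits (x : A -> nat) : Comp x -> Comp (fun a => bits (x a)).
Proof. by move=> cx; rewrite /bits; comp. Qed.

Lemma comp_parse (x : A -> nat) : Comp x -> Comp (fun a => parse (x a)).
Proof.
by move=> cx; rewrite /parse /parse_step; comp; exact: comp_bits.
Qed.

Lemma comp_nat_of_bitstring (x : A -> seq bool) :
  Comp x -> Comp (fun a => nat_of_bitstring (x a)).
Proof.
move=> cx; apply: (@comp_ext _ _ _ _ (fun a => foldl (fun n (b : bool) =>
  n * 2 + 1 + (if b then 1 else 0)) 0 (x a))).
  move=> a; rewrite /nat_of_bitstring; congr foldl; apply/funext => n; apply/funext => -[]; lia.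
by comp.
Qed.

End Strings.

Lemma comp_listing {A : Type} {eA : codable A} (x : A -> seq nat) :
  Comp x -> Comp (fun a => listing (map bits (x a)) : seq bool).
Proof.
move=> cx; rewrite /listing /self_delimiting; comp.
by refine (comp_bits _); comp.
Qed.

(** * The run and its machine *)

(* Here [c] is the length of the prefix by which the universal machine simulates the
   [block_machine] below; [eps c] exceeds epsilon(x) for the strings [x] of length [len c]
   used. There are [2 ^ idx c] slots, grouped at level [i] in blocks of [blk c i], and
   [(kol c i, alp c i)] is the input (k, alpha) for which level [i] waits. A slot has a
   program of length [kol c 0]: its number and a header. *)
Definition eps c := 2 ^ (c + 20).
Definition lev c := 2 * c + 4.
Definition idx c := eps c * (8 * c + 20).
Definition len c := eps c * (8 * c + 25).
Definition blk c i := 2 ^ (4 * eps c * i).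
Definition alp c i := idx c - 2 * eps c - 4 * eps c * i.
Definition kol c i := idx c + 2 * c + 2 - i.
Definition nprog c := 2 ^ idx c.

Section Process.
Variables (FU : nat -> nat -> nat) (FA : nat -> nat -> nat -> nat -> nat).

(* Time [t] is devoted to level [lev_at], program [prg_at] and running time [stg_at]. *)
Definition lev_at c t := t %% lev c.
Definition prg_at c t := t %/ lev c %% nprog c.
Definition stg_at c t := t %/ lev c %/ nprog c.

(** The first condition bounds the length of the program by [alp + eps]. The others make [stg_at]
    the first stage at which it has halted, so that a program causes one event per level. *)
Definition event c t :=
  [&& (prg_at c t).+2 <= 2 ^ (alp c (lev_at c t) + eps c + 1),
      ~~ (FU (stg_at c t) (prg_at c t) == 0)
    & (stg_at c t == 0) || (FU (stg_at c t).-1 (prg_at c t) == 0)].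

Definition event_set c t := parse (FU (stg_at c t) (prg_at c t)).-1.

(** Up to a factor of two, the number of a program plus one is 2 to the power of its length. So this
    is a bound on Lambda by about [kol c 0 + 3 * eps c], written without logarithms. *)
Definition small_set c t :=
  size (event_set c t) * (prg_at c t).+1 <= 2 ^ (kol c 0 + 3 * eps c + 1).

Definition avoided c t : seq nat :=
  flatten (mkseq (fun t' => if event c t' && small_set c t' then event_set c t'
                            else [::]) t).

(** The numbers searched are those of the strings of length [len c]. The default 0 is also the mark
    of a discarded slot; [fresh_spec] excludes it while there are at most [2 ^ idx c] slots. *)
Definition fresh c t (W : seq nat) :=
  head 0 [seq x <- iota (2 ^ len c - 1) (2 ^ len c)
         | ~~ ((x \in W) || (x \in avoided c t))].

(* K(x) < k has been observed by time [t]. *)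
Definition Klt t k x := has (fun p => FU t p == x.+1) (iota 0 (2 ^ k - 1)).

(** [FA] is shifted by one, so that its value 1 is the answer 0. *)
Definition answered c i t x := (FA t x (kol c i) (alp c i) == 1) || Klt t (kol c i) x.

(** Only complete blocks impose a wait. The second wait combines level [i.+1] with [kol c i],
    because the complete block of level [i.+1] is the model used for strings of complexity
    [kol c i]. *)
Definition ready1 c t W q i :=
  (~~ ((q %/ blk c i).+1 * blk c i <= size W) || answered c i t (nth 0 W q)) &&
  (~~ ((q %/ blk c i.+1).+1 * blk c i.+1 <= size W) || Klt t (kol c i) (nth 0 W q)).

Definition ready c t W :=
  all (fun q => (nth 0 W q == 0) || all (ready1 c t W q) (iota 0 (lev c)))
      (iota 0 (size W)).

(* Slots are indexed in order of emission and hold 0 once they are discarded: the last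
   block of size [s] is discarded and filled up. *)
Definition kill s (W : seq nat) :=
  mkseq (fun q => if q.+1 <= (size W).-1 %/ s * s then nth 0 W q else 0)
        (((size W).-1 %/ s).+1 * s).

Definition step c t W :=
  if event c t then kill (blk c (lev_at c t)) W
  else if ready c t W then rcons W (fresh c t W) else W.

Definition run c t := nat_rect (fun=> seq nat) [::] (step c) t.

(* The machine reads [1^c 0 1^i 0 beta]. *)
Definition prog_c (p : seq bool) := find (fun b => ~~ b) p.
Definition prog_i p := find (fun b => ~~ b) (drop (prog_c p).+1 p).
Definition prog_beta p := drop (prog_c p + prog_i p + 2) p.
Definition prog_num p := (nat_of_bitstring (prog_beta p)).+1 - 2 ^ size (prog_beta p).
(** A larger number in the place of the level switches to copying [prog_beta] literally. This mode
    gives every string a program, so that shortest lengths exist. *)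
Definition prog_block p := 4 * eps (prog_c p) * prog_i p <= idx (prog_c p).
Definition prog_ok p :=
  size p == prog_c p + prog_i p + 2 +
    (if prog_block p then idx (prog_c p) - 4 * eps (prog_c p) * prog_i p else prog_c p).

Definition halted p t :=
  prog_ok p && (~~ prog_block p ||
   ((prog_num p).+1 * blk (prog_c p) (prog_i p) <= size (run (prog_c p) t))).

Definition alive (W : seq nat) s b :=
  [seq x <- mkseq (fun q => nth 0 W (b * s + q)) s | ~~ (x == 0)].

Definition output p t : nat :=
  if prog_block p then
    if prog_i p == 0 then nth 0 (run (prog_c p) t) (prog_num p)
    else nat_of_bitstring (listing (map bits
      (alive (run (prog_c p) t) (blk (prog_c p) (prog_i p)) (prog_num p))))
  else nat_of_bitstring (prog_beta p).

Definition block_machine : machine := fun p y =>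
  exists t, [/\ halted p t, forall t', t' < t -> ~~ halted p t'
              & nat_of_bitstring y = output p t].

(** The unary header is self-delimiting, so both programs have the same [prog_c] and [prog_i]; by
    [prog_ok] these determine the length. *)
Lemma block_machine_prefix p q y z :
  block_machine p y -> block_machine q z -> prefix p q -> p = q.
Proof.
move=> [t [/andP[okp _] _ _]] [t' [/andP[okq _] _ _]] pq.
have E (s r : seq bool) : prefix s r -> find (fun b => ~~ b) s < size s ->
    find (fun b => ~~ b) r = find (fun b => ~~ b) s.
  by move=> /prefixP[u ->] H; rewrite find_cat has_find H.
have cp : prog_c p < size p by move: okp; rewrite /prog_ok; lia.
have cE : prog_c q = prog_c p by exact: E.
have iE : prog_i q = prog_i p.
  rewrite /prog_i cE; apply: E; last first.
    by rewrite size_drop -/(prog_i p); move: okp; rewrite /prog_ok; lia.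
  by move/prefixP: pq => [u ->]; rewrite drop_cat; case: ltnP => H; [exact: prefix_prefix|
    rewrite drop_oversize ?prefix0s//].
have sE : size q = size p.
  by move: okp okq; rewrite /prog_ok /prog_block cE iE => /eqP -> /eqP ->.
move/prefixP: pq => [u qE]; move: sE; rewrite qE size_cat => sE.
have u0 : u = [::] by by apply/size0nil/eqP; rewrite -(eqn_add2l (size p)) sE addn0.
by rewrite u0 cats0.
Qed.

Hypothesis cFU : Comp (fun p : nat * nat => FU p.1 p.2).
Hypothesis cFA : Comp (fun p : nat * nat * nat * nat => FA p.1.1.1 p.1.1.2 p.1.2 p.2).

Section Comp.
Context {A : Type} {eA : codable A}.

Lemma comp_FU (t p : A -> nat) : Comp t -> Comp p -> Comp (fun a => FU (t a) (p a)).
Proof. by move=> ct cp; exact: (comp_comp cFU (comp_pair ct cp)). Qed.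

Lemma comp_FA (t x k l : A -> nat) : Comp t -> Comp x -> Comp k -> Comp l ->
  Comp (fun a => FA (t a) (x a) (k a) (l a)).
Proof.
move=> ct cx ck cl.
exact: (comp_comp cFA (comp_pair (comp_pair (comp_pair ct cx) ck) cl)).
Qed.
End Comp.

Ltac comp_user ::= lazymatch goal with
  | |- Comp (fun a => FU _ _) => refine (comp_FU _ _)
  | |- Comp (fun a => FA _ _ _ _) => refine (comp_FA _ _ _ _)
  | |- Comp (fun a => bits _) => refine (comp_bits _)
  | |- Comp (fun a => parse _) => refine (comp_parse _)
  | |- Comp (fun a => nat_of_bitstring (listing (map bits _))) =>
       refine (comp_nat_of_bitstring (comp_listing _))
  | |- Comp (fun a => nat_of_bitstring _) => refine (comp_nat_of_bitstring _)
  end.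

Definition Comp2 B C D {eB : codable B} {eC : codable C} {eD : codable D} (f : B -> C -> D) :=
  Comp (fun p : B * C => f p.1 p.2).

Lemma comp2 A B C D {eA : codable A} {eB : codable B} {eC : codable C} {eD : codable D}
  (f : B -> C -> D) (x : A -> B) (y : A -> C) :
  Comp2 f -> Comp x -> Comp y -> Comp (fun a => f (x a) (y a)).
Proof. by move=> cf cx cy; exact: (comp_comp cf (comp_pair cx cy)). Qed.

Lemma comp_blk : Comp2 blk.
Proof. rewrite /Comp2 /blk /eps; comp. Qed.
Lemma comp_event : Comp2 event.
Proof. rewrite /Comp2 /event /prg_at /alp /lev_at /stg_at /lev /nprog /idx /eps; comp. Qed.
Lemma comp_event_set : Comp2 event_set.
Proof. rewrite /Comp2 /event_set /prg_at /stg_at /lev /nprog /idx /eps; comp. Qed.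
Lemma comp_small : Comp2 small_set.
Proof.
rewrite /Comp2 /small_set /kol /prg_at /lev /nprog /idx /eps; comp.
by apply: (comp2 comp_event_set); comp.
Qed.
Lemma comp_avoided : Comp2 avoided.
Proof.
rewrite /Comp2 /avoided; comp.
- by apply: (comp2 comp_event); comp.
- by apply: (comp2 comp_small); comp.
- by apply: (comp2 comp_event_set); comp.
Qed.
Lemma comp_fresh : Comp (fun p : nat * nat * seq nat => fresh p.1.1 p.1.2 p.2).
Proof.
rewrite /fresh /len /eps; comp.
by apply: (comp2 comp_avoided); comp.
Qed.
Lemma comp_ready1 :
  Comp (fun p : nat * nat * seq nat * nat * nat => ready1 p.1.1.1.1 p.1.1.1.2 p.1.1.2 p.1.2 p.2).
Proof. rewrite /ready1 /answered /Klt /blk /alp /kol /idx /eps; comp. Qed.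
Lemma comp_ready : Comp (fun p : nat * nat * seq nat => ready p.1.1 p.1.2 p.2).
Proof.
rewrite /ready /lev; comp.
apply: (comp_comp (g := fun p : nat * nat * seq nat * nat * nat => p) comp_ready1).
comp.
Qed.
Lemma comp_kill : Comp2 kill.
Proof. rewrite /Comp2 /kill; comp. Qed.

Lemma comp_run : Comp2 run.
Proof.
rewrite /Comp2 /run /step /lev_at /lev; comp.
- by apply: (comp2 comp_event); comp.
- by apply: (comp2 comp_kill); comp; apply: (comp2 comp_blk); comp.
- by apply: (comp_comp (g := fun p : nat * nat * nat * seq nat => (p.1.1.1, p.1.2, p.2))
    comp_ready); comp.
- by apply: (comp_comp (g := fun p : nat * nat * nat * seq nat => (p.1.1.1, p.1.2, p.2))
    comp_fresh); comp.
Qed.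

Lemma comp_halted : Comp2 halted.
Proof.
rewrite /Comp2 /halted /prog_ok /prog_num /prog_beta /prog_block /prog_i /prog_c /idx /blk
    /eps; comp.
by apply: (comp2 comp_run); comp.
Qed.

Lemma comp_output : Comp2 output.
Proof.
rewrite /Comp2 /output /prog_num /prog_beta /prog_block /prog_i /prog_c /alive /idx /blk /eps;
    comp;
by apply: (comp2 comp_run); comp.
Qed.

(** The least halting time is found by minimisation, and [output] is evaluated there. *)
Lemma block_machine_computable : computable_machine block_machine.
Proof.
have [h rh hE] : Comp (fun p : nat * nat => halted (bits p.1) p.2).
  by apply: (comp2 comp_halted); comp.
have [o ro oE] : Comp (fun p : nat * nat => output (bits p.1) p.2).
  by apply: (comp2 comp_output); comp.
(* Minimisation looks for a zero, hence the negated test. *)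
pose G (w : 2.-tuple nat) := 1 - h (cpair (tnth w (inord 1)) (tnth w (inord 0))).
have rG : rec G.
  apply: rec_sub; first exact: rec_const.
  by apply: Rec_rec rh _; apply: rec_cpair; exact: rec_proj.
pose O (w : 2.-tuple nat) := o (cpair (tnth w (inord 1)) (tnth w (inord 0))).
have rO : rec O by apply: Rec_rec ro _; apply: rec_cpair; exact: rec_proj.
have T0 t (v : 1.-tuple nat) : tnth [tuple of t :: v] (inord 0) = t.
  by rewrite (_ : inord 0 = ord0) ?tnth0//; apply: val_inj; rewrite /= inordK.
have T1 t (v : 1.-tuple nat) : tnth [tuple of t :: v] (inord 1) = thead v.
  by rewrite (_ : inord 1 = lift ord0 ord0) ?tnthS//; apply: val_inj; rewrite /= inordK.
have GE t (v : 1.-tuple nat) : G [tuple of t :: v] = ~~ halted (bits (thead v)) t.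
  rewrite /G T0 T1.
  by have := hE (thead v, t); rewrite /encode /= => ->; case: halted.
have OE t (v : 1.-tuple nat) : O [tuple of t :: v] = output (bits (thead v)) t.
  rewrite /O T0 T1.
  by have := oE (thead v, t); rewrite /encode /= => ->.
have GE' t p : G [tuple t; nat_of_bitstring p] = ~~ halted p t.
  have := GE t [tuple nat_of_bitstring p]; rewrite theadE bits_nat => <-.
  by congr G; apply: val_inj.
have OE' t p : O [tuple t; nat_of_bitstring p] = output p t.
  have := OE t [tuple nat_of_bitstring p]; rewrite theadE bits_nat => <-.
  by congr O; apply: val_inj.
pose mu (v : 1.-tuple nat) t := 0 = G [tuple of t :: v] /\
  forall z, z < t -> exists k, k.+1 = G [tuple of z :: v].
exists (fun (v : 1.-tuple nat) y => exists w : 2.-tuple nat,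
    (forall i : 'I_2, (if val i is 0 then mu v (tnth w i) else tnth w i = thead v)) /\
    y = O w).
  apply: (pr_comp (h := fun (i : 'I_2) v y => if val i is 0 then mu v y else y = thead v) rO).
  move=> -[[|[|k]] i2] //; last exact: (pr_proj ord0).
  exact: pr_min rG.
move=> p y; split=> [[t [ht tmin yE]]|[w [Hw yE]]].
- exists [tuple t; nat_of_bitstring p]; rewrite OE'; split=> // -[[|[|k]] i2] //.
  split; first by rewrite [RHS]GE' ht.
  by move=> z /tmin hz; exists 0; rewrite [RHS]GE' hz.
- have w1 : tnth w (lift ord0 ord0) = nat_of_bitstring p := Hw (lift ord0 ord0).
  have [H0 H1] : mu [tuple nat_of_bitstring p] (tnth w ord0) := Hw ord0.
  have wE : w = [tuple tnth w ord0; nat_of_bitstring p].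
    apply: eq_from_tnth => -[[|[|k]] i2] //; last rewrite -w1.
    - by congr tnth; exact: val_inj.
    - by congr tnth; exact: val_inj.
  exists (tnth w ord0); split; last by rewrite yE {1}wE OE'.
    by move: H0; rewrite [RHS]GE'; case: halted.
  by move=> z /H1[k]; rewrite [RHS]GE'; case: halted.
Qed.

Lemma block_machine_prefix_machine : prefix_machine block_machine.
Proof. by split; [exact: block_machine_computable|exact: block_machine_prefix]. Qed.
End Process.

(** * Combinatorics of the run *)

Section Run.
Variables (FU : nat -> nat -> nat) (FA : nat -> nat -> nat -> nat -> nat) (c : nat).
Local Notation W := (run FU FA c).
Local Notation event := (event FU c).
Local Notation ready := (ready FU FA c).
Local Notation fresh := (fresh FU c).
Local Notation blk := (blk c).
Local Notation end_of i q := ((q %/ blk i).+1 * blk i).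

Lemma blk_gt0 i : 0 < blk i. Proof. by rewrite expn_gt0. Qed.

Lemma blk_dvd i j : i <= j -> blk i %| blk j.
Proof. by move=> ij; apply: dvdn_exp2l; rewrite leq_mul2l ij orbT. Qed.

Lemma ltn_end i q : q < end_of i q.
Proof. exact: (ltn_ceil _ (blk_gt0 i)). Qed.

Lemma dvdn_lt_add s m n : s %| m -> s %| n -> m < n -> m + s <= n.
Proof.
case/dvdnP=> a -> /dvdnP[b ->]; have [->|s0] := posnP s; first by rewrite !muln0.
by rewrite ltn_pmul2r// addnC -mulSn leq_pmul2r.
Qed.

Lemma end_of_le i q m : blk i %| m -> q < m -> end_of i q <= m.
Proof.
move=> dm qm; rewrite mulSn addnC; apply: dvdn_lt_add => //; first exact: dvdn_mull.
by apply: leq_ltn_trans qm; exact: leq_trunc_div.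
Qed.

Lemma end_of_mono i j q : i <= j -> end_of i q <= end_of j q.
Proof.
move=> ij; apply: end_of_le (ltn_end j q).
exact: dvdn_trans (blk_dvd ij) (dvdn_mull _ (dvdnn _)).
Qed.

Lemma run_step t : W t.+1 = step FU FA c t (W t).
Proof. by []. Qed.

Lemma size_kill s (V : seq nat) : size (kill s V) = ((size V).-1 %/ s).+1 * s.
Proof. by rewrite size_mkseq. Qed.

Lemma leq_size_kill s (V : seq nat) : 0 < s -> size V <= size (kill s V).
Proof. by move=> s0; rewrite size_kill; have := ltn_ceil (size V).-1 s0; lia. Qed.

Lemma nth_kill s (V : seq nat) q : 0 < s -> nth 0 (kill s V) q != 0 ->
  q.+1 <= (size V).-1 %/ s * s /\ nth 0 (kill s V) q = nth 0 V q.
Proof.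
move=> s0; have [qs|qs] := ltnP q (size (kill s V)); last by rewrite nth_default.
by move: qs; rewrite size_kill => qs; rewrite nth_mkseq//; case: ifP.
Qed.

Lemma size_runS t : size (W t) <= size (W t.+1).
Proof.
rewrite run_step /step; case: ifP => _; first exact/leq_size_kill/blk_gt0.
by case: ifP => _ //; rewrite size_rcons.
Qed.

Lemma size_run t t' : t <= t' -> size (W t) <= size (W t').
Proof. by elim: t' => [|t' IH]; [rewrite leqn0 => /eqP ->|rewrite leq_eqVlt =>
    /predU1P[->//|/IH h]; exact: leq_trans h (size_runS _)]. Qed.

Lemma nth_runS t q : q < size (W t) -> nth 0 (W t.+1) q != 0 ->
  nth 0 (W t.+1) q = nth 0 (W t) q.
Proof.
move=> qW; rewrite run_step /step; case: ifP => _.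
  by case/(nth_kill (blk_gt0 _)).
by case: ifP => _ //; rewrite nth_rcons qW.
Qed.

Lemma nth_run t t' q : t <= t' -> q < size (W t) -> nth 0 (W t') q != 0 ->
  nth 0 (W t') q = nth 0 (W t) q.
Proof.
elim: t' => [|t' IH]; first by rewrite leqn0 => /eqP ->.
rewrite leq_eqVlt => /predU1P[->//|tt'] qW nz.
have E := nth_runS (leq_trans qW (size_run (ltnSE tt'))) nz.
by rewrite E IH// -?E//; exact: ltnSE tt'.
Qed.

Lemma nth_size (V : seq nat) q : nth 0 V q != 0 -> q < size V.
Proof. by case: ltnP => // ?; rewrite nth_default. Qed.

(** A kill appends only zeros, so a nonzero entry stems from an emission, made when the run had
    length [q]. *)
Lemma emitted t q : nth 0 (W t) q != 0 -> exists t0,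
  [/\ t0 < t, ~~ event t0, ready t0 (W t0), size (W t0) = q
    & fresh t0 (W t0) = nth 0 (W t) q].
Proof.
elim: t => [|t IH]; first by rewrite nth_nil.
move=> nz; have [qW|qW] := ltnP q (size (W t)).
  have E := nth_runS qW nz; have [|t0 [? ? ? ? h]] := IH; first by rewrite -E.
  by exists t0; split=> //; [exact: ltnW|rewrite E].
move: nz; rewrite run_step /step; case: ifPn => ev.
  case/(nth_kill (blk_gt0 _)) => h _; exfalso.
  by have := leq_trunc_div (size (W t)).-1 (blk (lev_at c t)); lia.
case: ifPn => rd; last by rewrite nth_default.
rewrite nth_rcons ltnNge qW /=; case: (eqVneq q (size (W t))) => // qE _.
by exists t; split.
Qed.

(** The later slot was filled by a value outside the list, which held the earlier value by then. *)
Lemma emitted_uniq t q q' : nth 0 (W t) q != 0 -> nth 0 (W t) q = nth 0 (W t) q' -> q = q'.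
Proof.
wlog: q q' / q <= q' => [H nz E|].
  have [|/ltnW] := leqP q q' => h; first exact: H.
  by apply/esym/H => //; rewrite -E.
rewrite leq_eqVlt => /predU1P[//|qq'] nz E.
have [|t0 [t0t _ _ sE fE]] := emitted (t := t) (q := q'); first by rewrite -E.
have nE := nth_run (ltnW t0t) (q := q) _ nz.
have fW : fresh t0 (W t0) \in W t0.
  by rewrite fE -E nE ?sE// mem_nth// sE.
move: fW; rewrite {1}/fresh; set s := seq.filter _ _.
case sS : s => [|x s'] /= fW.
  by move: nz; rewrite E -fE /fresh -/s sS.
have : x \in s by rewrite sS inE eqxx.
by rewrite mem_filter fW.
Qed.

(** Survivors lie before the discarded block, which starts at a multiple of the block size. This
    block is filled up with zeros, so the size exceeds the end of every surviving block. *)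
Lemma event_alive t q : event t -> nth 0 (W t.+1) q != 0 ->
  end_of (lev_at c t) q < size (W t.+1).
Proof.
rewrite run_step /step => ev; rewrite ev => /(nth_kill (blk_gt0 _))[h _].
rewrite size_kill mulSn -addn1 addnC leq_add ?blk_gt0//.
by apply: end_of_le => //; exact: dvdn_mull.
Qed.

(** As long as [q] survives, no kill can carry the size past the end of its block. Hence an emission
    does, and this requires [ready]. *)
Lemma passed t q i : nth 0 (W t) q != 0 -> end_of i q < size (W t) -> exists t',
  [/\ t' < t, ready t' (W t'), size (W t') = end_of i q & nth 0 (W t') q = nth 0 (W t) q].
Proof.
elim: t => [|t IH] nz; first by rewrite nth_nil in nz.
have [lt|ge] := ltnP (end_of i q) (size (W t)).
  have E := nth_runS (ltn_trans (ltn_end i q) lt) nz.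
  have nz' : nth 0 (W t) q != 0 by rewrite -E.
  have [t' [t't rd sE h]] := IH nz' lt.
  by exists t'; split; rewrite ?E// ltnW.
move: (nz); rewrite {2}run_step {1}run_step /step; case: ifPn => ev.
- move=> /(nth_kill (blk_gt0 _)); set j := lev_at c t; rewrite size_kill => -[h _] h'.
  have [ij|ji] := leqP i j.
    (* A survivor of a kill of level at least [i] has its whole block before the discarded one, so
       the end had been passed already. *)
    have : end_of i q <= (size (W t)).-1 %/ blk j * blk j.
      apply: end_of_le => //; exact: dvdn_trans (blk_dvd ij) (dvdn_mull _ (dvdnn _)).
    by have := leq_trunc_div (size (W t)).-1 (blk j); lia.
  (* A smaller block is filled up at most to the end of the block of level [i] around it. *)
  have : (size (W t)).-1 %/ blk j * blk j + blk j <= end_of i q.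
    apply: dvdn_lt_add; first exact: dvdn_mull.
      by apply: dvdn_trans (blk_dvd (ltnW ji)) (dvdn_mull _ (dvdnn _)).
    by have := leq_trunc_div (size (W t)).-1 (blk j); lia.
  by move: h'; rewrite mulSn; lia.
- case: ifPn => rd; last by rewrite ltnNge ge.
  rewrite size_rcons ltnS => _ le; have sE : size (W t) = end_of i q by lia.
  exists t; split=> //; rewrite (nth_runS _ nz)// sE; exact: ltn_end.
Qed.

(** * Counting events, discarded slots and avoided strings *)

Hypothesis FUm : forall p t t', t <= t' -> FU t p != 0 -> FU t' p = FU t p.

Lemma lev_gt0 : 0 < lev c. Proof. by rewrite /lev; lia. Qed.
Lemma nprog_gt0 : 0 < nprog c. Proof. by rewrite expn_gt0. Qed.
Lemma lev_at_lt t : lev_at c t < lev c. Proof. by rewrite ltn_mod lev_gt0. Qed.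

(** [stg_at] is the first halting stage of the program, hence determined by it. *)
Lemma event_inj t t' : event t -> event t' ->
  lev_at c t = lev_at c t' -> prg_at c t = prg_at c t' -> t = t'.
Proof.
move=> /and3P[_ h1 h2] /and3P[_ h1' h2'] lE pE.
suff sE : stg_at c t = stg_at c t'.
  rewrite (divn_eq t (lev c)) (divn_eq t' (lev c)) -/(lev_at c t) -/(lev_at c t') lE.
  rewrite (divn_eq (t %/ _) (nprog c)) (divn_eq (t' %/ _) (nprog c)).
  by rewrite -/(stg_at c t) -/(stg_at c t') sE -/(prg_at c t) -/(prg_at c t') pE.
rewrite -pE in h1' h2'; move: h1 h2 h1' h2'.
move: (stg_at c t) (stg_at c t') (prg_at c t) => s s' p h1 h2 h1' h2'.
case: (ltngtP s s') => // lt; exfalso.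
  by case: s' lt h1' h2' => // s' /ltnSE le _ /=; rewrite (FUm le h1) (negbTE h1).
by case: s lt h1 h2 => // s /ltnSE le _ /=; rewrite (FUm le h1') (negbTE h1').
Qed.

Lemma event_at i p : i < lev c -> p.+2 <= 2 ^ (alp c i + eps c + 1) ->
  (exists u, FU u p != 0) ->
  exists2 t, event t & [/\ lev_at c t = i, prg_at c t = p & FU (stg_at c t) p != 0].
Proof.
move=> il pl ex; case: (ex_minnP ex) => u hu umin.
have pN : p < nprog c.
  have : p.+2 <= 2 ^ idx c; last by rewrite /nprog; lia.
  apply: leq_trans pl _; rewrite leq_exp2l// /alp /idx.
  have : 20 < eps c.
    by rewrite /eps; apply: leq_trans (ltn_expl 20 (ltnSn 1)) _; rewrite leq_exp2l//; lia.
  by lia.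
(* The time devoted to level [i], program [p] and its first halting stage [u]. *)
pose t := (u * nprog c + p) * lev c + i.
have lE : lev_at c t = i by rewrite /lev_at /t modnMDl modn_small.
have tE : t %/ lev c = u * nprog c + p by rewrite /t divnMDl ?lev_gt0// divn_small ?addn0.
have pE : prg_at c t = p by rewrite /prg_at tE modnMDl modn_small.
have sE : stg_at c t = u by rewrite /stg_at tE divnMDl ?nprog_gt0// divn_small ?addn0.
exists t; last by rewrite sE.
rewrite /event lE pE sE pl hu /=; case: u umin {t lE tE pE sE hu} => //= u umin.
by apply/negPn/negP => /umin; rewrite ltnn.
Qed.

(** Each pair of a level and a program has at most one event, so the sum over events is at most the
    sum over pairs; [b] is the indicator used for double counting. *)
Lemma event_sum (w : nat -> nat -> nat) T :
  \sum_(t < T | event t) w (lev_at c t) (prg_at c t) <=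
  \sum_(i < lev c) \sum_(p < 2 ^ (alp c i + eps c + 1) - 1) w i p.
Proof.
pose N i := 2 ^ (alp c i + eps c + 1) - 1.
pose b (t : nat) i p := event t && ((lev_at c t == i) && (prg_at c t == p)).
have h1 (t : 'I_T) : event t ->
    w (lev_at c t) (prg_at c t) <= \sum_(i < lev c) \sum_(p < N i) b t i p * w i p.
  move=> ev; have pP : prg_at c t < N (lev_at c t) by rewrite /N; case/and3P: ev; lia.
  rewrite (bigD1 (Ordinal (lev_at_lt t)))//= (bigD1 (Ordinal pP))//=.
  by rewrite /b ev !eqxx mul1n -addnA leq_addr.
have h2 i p : \sum_(t < T | event t) b t i p <= 1.
  rewrite (eq_bigr (fun t : 'I_T => if b t i p then 1 else 0)); last by move=> t _;
      case: (b t i p).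
  rewrite -big_mkcondr sum1_card; apply/fintype.card_le1_eqP => t t'.
  rewrite !unfold_in /= => /and3P[ev _ /andP[/eqP lE /eqP pE]] /and3P[ev' _ /andP[/eqP lE' /eqP
      pE']].
  by apply: val_inj; apply: event_inj; rewrite ?lE ?pE.
apply: leq_trans (leq_sum _ _) _; first exact: h1.
rewrite exchange_big /=; apply: leq_sum => i _.
rewrite exchange_big /=; apply: leq_sum => p _.
by rewrite -big_distrl /= -[leqRHS]mul1n leq_mul2r h2 orbT.
Qed.

Lemma kill_take s (V : seq nat) : 0 < s ->
  kill s V = take ((size V).-1 %/ s * s) V ++ nseq s 0.
Proof.
move=> s0; have le : (size V).-1 %/ s * s <= size V.
  by apply: leq_trans (leq_trunc_div _ _) (leq_pred _).
apply: (@eq_from_nth _ 0) => [|q]; rewrite size_kill.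
  by rewrite size_cat size_nseq size_takel// mulSn addnC.
move=> qs; rewrite nth_mkseq// nth_cat size_takel//.
by case: ltnP => h; [rewrite nth_take|rewrite nth_nseq if_same].
Qed.

Lemma count_kill s (V : seq nat) : 0 < s ->
  count (pred1 0) (kill s V) <= count (pred1 0) V + s.
Proof.
move=> s0; rewrite kill_take// count_cat count_nseq /= mul1n leq_add2r.
by rewrite -[V in leqRHS](cat_take_drop ((size V).-1 %/ s * s) V) count_cat leq_addr.
Qed.

Lemma count_dead t : (forall t', t' < t -> fresh t' (W t') != 0) ->
  count (pred1 0) (W t) <= \sum_(t' < t | event t') blk (lev_at c t').
Proof.
elim: t => [|t IH] fr; first by rewrite big_ord0.
have {}IH := IH (fun t' lt => fr t' (ltnW lt)).
rewrite big_mkcond big_ord_recr /= -big_mkcond /= /step; case: ifPn => ev.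
  by apply: leq_trans (count_kill _ (blk_gt0 _)) _; rewrite leq_add2r.
rewrite addn0; case: ifPn => // rd; rewrite -cats1 count_cat /=.
by rewrite (negbTE (fr t (ltnSn t))) !addn0.
Qed.

(** Dyadic grouping: the terms from [2 ^ a - 1] to [2 ^ a.+1 - 2] are [2 ^ a] in number, each at
    most [2 ^ X %/ 2 ^ a]. *)
Lemma harmonic a X : \sum_(p < 2 ^ a - 1) 2 ^ X %/ p.+1 <= a * 2 ^ X.
Proof.
rewrite -(big_mkord xpredT (fun p => 2 ^ X %/ p.+1)).
elim: a => [|a IH]; first by rewrite big_geq.
have h : 0 < 2 ^ a by rewrite expn_gt0.
rewrite (big_cat_nat (n := 2 ^ a - 1))//=; last by rewrite expnS; lia.
rewrite mulSn addnC leq_add//.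
apply: leq_trans (_ : \sum_(2 ^ a - 1 <= p < 2 ^ a.+1 - 1) 2 ^ X %/ 2 ^ a <= _).
  rewrite big_nat_cond [leqRHS]big_nat_cond; apply: leq_sum => p /andP[/andP[le _] _].
  by apply: leq_div2l => //; lia.
rewrite sum_nat_const_nat expnS mul2n -addnn.
rewrite (_ : _ - _ = 2 ^ a); last lia.
by rewrite mulnC leq_trunc_div.
Qed.

(** A small set announced by program [p] has at most [2 ^ X %/ p.+1] elements; by [harmonic] this
    sums to at most [idx c * 2 ^ X] per level. *)
Lemma size_avoided t :
  size (avoided FU c t) <= lev c * (idx c * 2 ^ (kol c 0 + 3 * eps c + 1)).
Proof.
set X := kol c 0 + 3 * eps c + 1.
have -> : size (avoided FU c t) = \sum_(t' < t) size (if event t' && small_set FU c t'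
    then event_set FU c t' else [::]).
  rewrite /avoided size_flatten /shape /mkseq -map_comp sumnE big_map.
  by rewrite -(big_mkord xpredT (fun t' => size (if event t' && small_set FU c t'
    then event_set FU c t' else [::]))) /index_iota subn0.
apply: leq_trans (_ : \sum_(t' < t | event t') 2 ^ X %/ (prg_at c t').+1 <= _).
  rewrite [leqRHS]big_mkcond /=; apply: leq_sum => t' _; case: (event t') => //=.
  by case: ifP => // h; rewrite leq_divRL.
apply: leq_trans (event_sum (fun _ p => 2 ^ X %/ p.+1) _) _.
apply: leq_trans (_ : \sum_(i < lev c) idx c * 2 ^ X <= _); last first.
  by rewrite sum_nat_const card_ord.
apply: leq_sum => i _; apply: leq_trans (harmonic _ _) _.
rewrite leq_mul2r /alp; apply/orP; right.
have : 0 < eps c by rewrite expn_gt0.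
by rewrite /idx; nia.
Qed.

Lemma eps_ge : 32 * c.+1 <= eps c.
Proof.
rewrite /eps (_ : c + 20 = 5 + (c + 15)); last lia.
rewrite expnD leq_mul2l /=; apply: leq_trans (ltn_expl c (ltnSn 1)) _.
by rewrite leq_exp2l// leq_addr.
Qed.

Lemma lev_le : lev c <= 2 ^ (c + 3).
Proof.
have := ltn_expl c (ltnSn 1); rewrite /lev expnD; lia.
Qed.

(** The factors [lev c] and [idx c] and the header cost are absorbed by one [eps c], so at most
    [2 ^ (idx c + 4 * eps c)] strings are avoided. The exponent [len c] is larger by a further
    [eps c]. *)
Lemma room t : 2 ^ idx c + size (avoided FU c t) < 2 ^ len c.
Proof.
have e32 := eps_ge.
apply: leq_ltn_trans (_ : 2 ^ idx c + 2 ^ (idx c + 4 * eps c) < _).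
  rewrite leq_add2l; apply: leq_trans (size_avoided t) _.
  apply: leq_trans (_ : 2 ^ (c + 3) * (2 ^ (c + 20) * 2 ^ (c + 5) *
    2 ^ (kol c 0 + 3 * eps c + 1)) <= _).
    rewrite leq_mul ?lev_le// leq_mul2r; apply/orP; right.
    rewrite /idx -/(eps c) leq_mul2l; apply/orP; right.
    by have := ltn_expl c (ltnSn 1); rewrite expnD; lia.
  by rewrite -!expnD leq_exp2l// /kol; lia.
have -> : len c = (idx c + 4 * eps c) + eps c by rewrite /len /idx; lia.
rewrite [ltnRHS]expnD; apply: leq_ltn_trans (_ : 2 ^ (idx c + 4 * eps c) * 2 < _).
  by rewrite muln2 -addnn leq_add2r leq_exp2l// leq_addr.
by rewrite ltn_pmul2l ?expn_gt0// -{1}(expn1 2) ltn_exp2l//; lia.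
Qed.

Lemma fresh_spec t (V : seq nat) : size V <= 2 ^ idx c ->
  [/\ 2 ^ len c - 1 <= fresh t V < 2 ^ len c - 1 + 2 ^ len c, fresh t V \notin V
    & fresh t V \notin avoided FU c t].
Proof.
move=> sV; rewrite /fresh; set s := seq.filter _ _.
have : s != [::].
  apply/negP => /eqP s0.
  have : size (iota (2 ^ len c - 1) (2 ^ len c)) <= size (V ++ avoided FU c t).
    apply: uniq_leq_size (iota_uniq _ _) _ => x xi; rewrite mem_cat.
    have : x \notin s by rewrite s0.
    by rewrite mem_filter xi andbT negbK.
  by rewrite size_iota size_cat; have := room t; lia.
case sE : s => [|x s'] //= _.
have : x \in s by rewrite sE inE eqxx.
by rewrite mem_filter negb_or mem_iota => /andP[/andP[-> ->] ->].
Qed.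

(** Level [i] has fewer than [2 ^ (alp c i + eps c + 1)] events, each costing at most [blk c i]
    slots. The product is at most [2 ^ (idx c - eps c + 1)] at every level, and [eps c] absorbs the
    factor [lev c]. *)
Lemma dead_le t : (forall t', t' < t -> size (W t') <= 2 ^ idx c) ->
  count (pred1 0) (W t) <= 2 ^ (idx c - 1).
Proof.
move=> sz; have e32 := eps_ge.
apply: leq_trans (count_dead _) _.
  move=> t' /sz/(fresh_spec t')[/andP[+ _] _ _].
  have : 2 ^ 1 <= 2 ^ len c by rewrite leq_exp2l// /len; nia.
  by lia.
apply: leq_trans (event_sum (fun i _ => blk i) _) _.
apply: leq_trans (_ : \sum_(i < lev c) 2 ^ (idx c - eps c + 1) <= _).
  apply: leq_sum => i _; rewrite sum_nat_const card_ord.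
  apply: leq_trans (_ : 2 ^ (alp c i + eps c + 1) * blk i <= _).
    by rewrite leq_mul2r leq_subr orbT.
  rewrite -expnD leq_exp2l// /alp /idx; have := ltn_ord i; rewrite {2}/lev => il.
  have : eps c * (2 + 4 * i) <= eps c * (8 * c + 20) by rewrite leq_mul2l; lia.
  by rewrite mulnDr; lia.
rewrite sum_nat_const card_ord; apply: leq_trans (leq_mul lev_le (leqnn _)) _.
rewrite -expnD leq_exp2l//; have : eps c <= idx c by rewrite /idx; nia.
lia.
Qed.
End Run.

(** * Programs of slots and blocks *)

Lemma shortest_lengthP (P : bitstring -> Prop) : (exists p, P p) ->
  (exists2 p, P p & size p = shortest_length P) /\
  (forall p, P p -> shortest_length P <= size p).
Proof.
move=> [p0 Pp0].
have ex : exists n, `[< exists2 p, P p & size p = n >].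
  by exists (size p0); apply/asboolP; exists p0.
case: (ex_minnP ex) => m /asboolP hm mmin.
have H : [set n | (exists2 p, P p & size p = n) /\ forall p, P p -> n <= size p]%classic m.
  by split=> // p Pp; apply: mmin; apply/asboolP; exists p.
by have [] := xgetPex 0 (ex_intro _ m H).
Qed.

Definition header c i := nseq c true ++ false :: nseq i true ++ [:: false].

Lemma find_nseq n s : find (fun b => ~~ b) (nseq n true ++ false :: s) = n.
Proof. by elim: n => //= n ->. Qed.

Lemma headerE c i s : header c i ++ s = nseq c true ++ false :: (nseq i true ++ false :: s).
Proof. by rewrite /header -catA /= -catA. Qed.

Lemma size_header c i : size (header c i) = c + i + 2.
Proof. by rewrite /header size_cat /= size_cat !size_nseq /=; lia. Qed.

Lemma prog_c_header c i s : prog_c (header c i ++ s) = c.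
Proof. by rewrite headerE; exact: find_nseq. Qed.

Lemma prog_i_header c i s : prog_i (header c i ++ s) = i.
Proof.
rewrite /prog_i prog_c_header headerE -cat_rcons drop_size_cat ?size_rcons ?size_nseq//.
exact: find_nseq.
Qed.

Lemma prog_beta_header c i s : prog_beta (header c i ++ s) = s.
Proof.
by rewrite /prog_beta prog_c_header prog_i_header drop_size_cat// size_header.
Qed.

(** For [b < 2 ^ m], the string of length [m] with index [b], by [nat_of_size]. *)
Definition index_string m b := bits (2 ^ m - 1 + b).

Lemma size_index_string m b : b < 2 ^ m -> size (index_string m b) = m.
Proof.
move=> bm; have := nat_of_size (index_string m b); rewrite nat_bits => /andP[h1 h2].
have h0 : 0 < 2 ^ m by rewrite expn_gt0.
have h3 : 2 ^ size (index_string m b) < 2 ^ m.+1.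
  by apply: leq_ltn_trans h1 _; rewrite expnS; lia.
have h4 : 2 ^ m < 2 ^ (size (index_string m b)).+1 by apply: leq_ltn_trans h2; lia.
rewrite !ltn_exp2l// in h3 h4.
by apply/eqP; rewrite eqn_leq -ltnS h3 -ltnS h4.
Qed.

Lemma num_index_string m b : b < 2 ^ m ->
  (nat_of_bitstring (index_string m b)).+1 - 2 ^ size (index_string m b) = b.
Proof.
move=> bm; rewrite size_index_string// nat_bits.
have h0 : 0 < 2 ^ m by rewrite expn_gt0.
lia.
Qed.

Section Machine.
Variables (FU : nat -> nat -> nat) (FA : nat -> nat -> nat -> nat -> nat).
Local Notation T := (block_machine FU FA).

Lemma halting p : (exists t, halted FU FA p t) -> exists t,
  [/\ halted FU FA p t, (forall t', halted FU FA p t' -> t <= t')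
    & T p (bits (output FU FA p t))].
Proof.
move=> /ex_minnP[t ht tmin]; exists t; split=> //; exists t; split=> //; last exact: nat_bits.
by move=> t' lt; apply/negP => /tmin; rewrite leqNgt lt.
Qed.

Lemma machine_any y : exists p, T p y.
Proof.
(* [(idx c).+1] is too large for a level and selects the literal mode. *)
pose c := size y; pose p := header c (idx c).+1 ++ y.
have nb : prog_block p = false.
  rewrite /prog_block /p prog_c_header prog_i_header mulnS.
  have : 0 < eps c by rewrite expn_gt0.
  by apply: contraTF; nia.
have [|t [_ _]] := @halting p.
  exists 0; rewrite /halted /prog_ok nb /p prog_c_header prog_i_header.
  by rewrite size_cat size_header eqxx.
by rewrite /output nb /p prog_beta_header bits_nat; exists p.
Qed.

Variable c : nat.
Local Notation W := (run FU FA c).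

(** The program halts as soon as its block is complete, possibly before [t]; the output is read off
    the run at that time [t0]. *)
Lemma machine_block i b t :
  4 * eps c * i <= idx c -> b < 2 ^ (idx c - 4 * eps c * i) ->
  b.+1 * blk c i <= size (W t) ->
  exists p t0, [/\ size p = c + i + 2 + (idx c - 4 * eps c * i), t0 <= t,
    b.+1 * blk c i <= size (W t0) &
    T p (if i == 0 then bits (nth 0 (W t0) b)
         else listing (map bits (alive (W t0) (blk c i) b)))].
Proof.
move=> ib bm bt; pose p := header c i ++ index_string (idx c - 4 * eps c * i) b.
have pb : prog_block p by rewrite /prog_block /p prog_c_header prog_i_header.
have hE t' : halted FU FA p t' = (b.+1 * blk c i <= size (W t')).
  rewrite /halted /prog_ok pb /p prog_c_header prog_i_header size_cat size_header.
  rewrite size_index_string// eqxx /= /prog_num prog_beta_header num_index_string//.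
have [|t0 [ht0 tmin Tp]] := @halting p; first by exists t; rewrite hE.
exists p, t0; split=> //.
- by rewrite size_cat size_header size_index_string.
- by apply: tmin; rewrite hE.
- by rewrite -hE.
move: Tp; rewrite /output pb /p prog_c_header prog_i_header.
rewrite /prog_num prog_beta_header num_index_string//.
by case: eqVneq => // _; rewrite bits_nat.
Qed.

Lemma machine_slot q t : q < 2 ^ idx c -> nth 0 (W t) q != 0 ->
  exists2 p, size p = c + 2 + idx c & T p (bits (nth 0 (W t) q)).
Proof.
move=> qi nz; have b0 : blk c 0 = 1 by rewrite /blk muln0.
have [|||p [t0 [sp t0t sz Tp]]] := @machine_block 0 q t.
- by rewrite muln0.
- by rewrite muln0 subn0.
- by rewrite b0 muln1; exact: nth_size.
exists p; first by rewrite sp muln0; lia.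
by rewrite (nth_run t0t)//; rewrite b0 muln1 in sz.
Qed.

Lemma alive_uniq t s b : uniq (alive (W t) s b).
Proof.
rewrite /alive /mkseq filter_map map_inj_in_uniq ?filter_uniq ?iota_uniq//.
move=> q q'; rewrite !mem_filter /= => /andP[nz _] _.
by move=> /(emitted_uniq nz); lia.
Qed.

(* The elements of a block that are alive when the run leaves it contain those that
   are alive later. *)
Lemma machine_cover i b t :
  0 < i -> 4 * eps c * i <= idx c -> b < 2 ^ (idx c - 4 * eps c * i) ->
  b.+1 * blk c i <= size (W t) ->
  exists p (S : {fset bitstring}),
    [/\ size p = c + i + 2 + (idx c - 4 * eps c * i),
        exists2 s, perm_eq s (enum_fset S) & T p (listing s),
        #|` S|%fset <= blk c i &
        forall q, q %/ blk c i = b -> nth 0 (W t) q != 0 -> bits (nth 0 (W t) q) \in S].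
Proof.
move=> i0 ib bm bt; have [p [t0 [sp t0t sz Tp]]] := machine_block ib bm bt.
rewrite (gtn_eqF i0) in Tp.
set s := map bits _ in Tp; have us : uniq s.
  by rewrite map_inj_uniq ?alive_uniq//; exact: bits_inj.
exists p, (seq_fset tt s); split=> //.
- exists s => //; rewrite perm_sym -{2}(undup_id us); exact: seq_fset_perm.
- rewrite size_seq_fset undup_id// size_map size_filter.
  by apply: leq_trans (count_size _ _) _; rewrite size_mkseq.
move=> q qb nz; rewrite seq_fsetE; apply: map_f.
have qW : q < size (W t0).
  by apply: leq_trans sz; rewrite -qb; exact: ltn_ceil (blk_gt0 c i).
rewrite (nth_run t0t)// mem_filter -(nth_run t0t)// nz /=.
apply/mapP; exists (q %% blk c i); first by rewrite mem_iota /= add0n ltn_mod blk_gt0.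
by rewrite (nth_run t0t)// -qb -divn_eq.
Qed.
End Machine.

(** * Observed upper bounds on complexity *)

Section Knowledge.
Variables (U : machine) (FU : nat -> nat -> nat).
Hypothesis UE : forall p y, U p y <->
  exists t, FU t (nat_of_bitstring p) = (nat_of_bitstring y).+1.
Hypothesis FUm : forall p t t', t <= t' -> FU t p != 0 -> FU t' p = FU t p.

Lemma Klt_mono t t' k x : t <= t' -> Klt FU t k x -> Klt FU t' k x.
Proof.
move=> tt' /hasP[p pk /eqP px]; apply/hasP; exists p => //.
by rewrite (FUm tt') ?px.
Qed.

Lemma lt_code p k : nat_of_bitstring p < 2 ^ k - 1 <-> size p < k.
Proof.
have /andP[h1 h2] := nat_of_size p; have h0 : 0 < 2 ^ k by rewrite expn_gt0.
split=> [lt|lt].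
  by rewrite -(ltn_exp2l _ _ (ltnSn 1)); apply: leq_ltn_trans h1 _; lia.
have : 2 ^ (size p).+1 <= 2 ^ k by rewrite leq_exp2l.
lia.
Qed.

Lemma KltP k x : (exists t, Klt FU t k x) <-> exists2 p, U p (bits x) & size p < k.
Proof.
split=> [[t /hasP[p]]|[p /UE[t Ft] pk]].
  rewrite mem_iota add0n /= -{1 2}(nat_bits p) => /lt_code pk /eqP px.
  by exists (bits p) => //; apply/UE; exists t; rewrite px nat_bits.
exists t; apply/hasP; exists (nat_of_bitstring p); last by rewrite Ft nat_bits.
by rewrite mem_iota add0n /=; apply/lt_code.
Qed.

(* There are fewer than [2 ^ k] programs shorter than [k]. *)
Lemma count_Klt k (s : seq nat) : uniq s ->
  (forall x, x \in s -> exists t, Klt FU t k x) -> size s <= 2 ^ k - 1.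
Proof.
move=> us /= h.
have h' x : exists t, x \in s -> Klt FU t k x.
  by case: (boolP (x \in s)) => [/h[t kt]|_]; [exists t|exists 0].
have [tx htx] := choice h'.
pose t := \max_(x <- s) tx x.
have ht x : x \in s -> Klt FU t k x.
  move=> xs; apply: Klt_mono (htx x xs); exact: leq_bigmax_seq.
have /choice[g hg] : forall x, exists p, x \in s -> p < 2 ^ k - 1 /\ FU t p = x.+1.
  move=> x; case: (boolP (x \in s)) => [/ht/hasP[p]|_]; last by exists 0.
  by rewrite mem_iota => /andP[_ pk] /eqP px; exists p.
rewrite -(size_map g) -(size_iota 0 (2 ^ k - 1)); apply: uniq_leq_size.
  rewrite map_inj_in_uniq// => x y xs ys gxy.
  by apply: succn_inj; have [[_ <-] [_ <-]] := (hg x xs, hg y ys); rewrite gxy.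
by move=> p /mapP[x xs ->]; rewrite mem_iota; have [] := hg x xs.
Qed.
End Knowledge.

(** * Bounds on the structure function *)
Import Order.TTheory GRing.Theory Num.Theory.

Section Reals.
Variable R : realType.
Local Open Scope ring_scope.

Lemma ln2_gt0 : 0 < ln (2 : R).
Proof. by rewrite ln_gt0// ltr1n. Qed.

Lemma log2_exp m : log2 ((2 ^ m)%:R : R) = m%:R.
Proof.
rewrite /log2 natrX lnXn// -[X in X / _]mulr_natl mulfK// gt_eqF//; exact: ln2_gt0.
Qed.

Lemma ler_log2 (a b : nat) : (0 < a)%N -> (a <= b)%N -> log2 (a%:R : R) <= log2 b%:R.
Proof.
move=> a0 ab; rewrite /log2 ler_pM2r ?invr_gt0 ?ln2_gt0//.
by rewrite ler_ln ?posrE ?ltr0n ?ler_nat//; apply: leq_trans ab.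
Qed.

Lemma log2_le (s m : nat) : (0 < s)%N -> (s <= 2 ^ m)%N -> log2 (s%:R : R) <= m%:R.
Proof. by move=> s0 sm; rewrite -(log2_exp m); exact: ler_log2. Qed.

Lemma log2_ge (s m : nat) : (2 ^ m <= s)%N -> m%:R <= log2 (s%:R : R).
Proof. by move=> sm; rewrite -(log2_exp m); apply: ler_log2 => //; rewrite expn_gt0. Qed.

Lemma log2_lt (s m : nat) : log2 (s%:R : R) < m%:R -> (s < 2 ^ m)%N.
Proof. by apply: contraTltn => /log2_ge; rewrite -leNgt. Qed.

(** [log2 (len c)] is at least [c + 20], and [10 * (c + 20)] exceeds the cofactor [8 * c + 25] of
    [eps c] in [len c]. *)
Lemma epsilon_bounds (c : nat) (x : bitstring) : size x = len c ->
  0 <= epsilon R x < (eps c)%:R.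
Proof.
move=> sx; have lc : (2 ^ (c + 20) <= len c)%N.
  by rewrite /len -/(eps c) leq_pmulr//; lia.
have lg : (c + 20)%:R <= log2 ((len c)%:R : R) by exact: log2_ge.
have lg0 : 0 < 10 * log2 ((len c)%:R : R).
  by apply: mulr_gt0 => //; apply: lt_le_trans lg; rewrite ltr0n; lia.
rewrite /epsilon sx; apply/andP; split; first by apply: divr_ge0 => //; exact: ltW.
rewrite ltr_pdivrMr//.
apply: lt_le_trans (_ : (eps c)%:R * (10 * (c + 20)%:R) <= _); last first.
  by rewrite ler_wpM2l// ler_wpM2l.
rewrite -!natrM ltr_nat /len ltn_pmul2l ?expn_gt0//; lia.
Qed.

Section Lambda.
Variables (U : machine) (x : bitstring) (k al e : nat) (ep : R).
Hypothesis ep_e : 0 <= ep < e%:R.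

(** Replacing [ep] by the larger [e] makes the bound on the infimum strict, so that some set lies
    below it. Its logarithm is cleared to obtain the integer form that [small_set] tests. *)
Lemma lambda_not_large :
  ~ ((k%:R + 3 * ep)%:E < lambda U x (al%:R + ep))%E ->
  exists S : {fset bitstring}, [/\ x \in S, (KS U S <= al + e)%N &
    (#|` S|%fset * 2 ^ KS U S < 2 ^ (k + 3 * e))%N].
Proof.
have /andP[ep0 epe] := ep_e; move=> /negP; rewrite -leNgt => le.
have /ereal_inf_lt[_ [S [xS KSa] <-]] : (lambda U x (al%:R + ep) < (k%:R + 3 * e%:R)%:E)%E.
  by apply: le_lt_trans le _; rewrite lte_fin; lra.
rewrite lte_fin /Lambda => Llt; exists S; split=> //.
  rewrite -(ler_nat R) natrD; apply: le_trans KSa _; lra.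
have Sgt : (0 < #|` S|%fset)%N by rewrite cardfs_gt0; apply/fset0Pn; exists x.
(* The logarithm of the size is nonnegative, so the subtraction of exponents below is exact. *)
have KSk : (KS U S <= k + 3 * e)%N.
  have l0 := @log2_ge #|` S|%fset 0 Sgt.
  rewrite -(ler_nat R) natrD natrM; lra.
rewrite -ltn_divRL// ?expn_gt0//; last by rewrite dvdn_exp2l.
rewrite -expnB//; apply: log2_lt.
rewrite natrB// natrD natrM; lra.
Qed.

Lemma lambda_small (S : {fset bitstring}) s m : x \in S -> (KS U S + e <= al)%N ->
  (#|` S|%fset <= 2 ^ s)%N -> (KS U S + s < k + 6 * m)%N -> (2 ^ m <= k)%N ->
  (lambda U x (al%:R - ep) < (k%:R + 6 * log2 k%:R)%:E)%E.
Proof.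
have /andP[ep0 epe] := ep_e; move=> xS KSa Ss KSs mk.
apply: le_lt_trans (_ : (_ <= (Lambda R U S)%:E)%E) _.
  apply: ereal_inf_lbound; exists S => //; split=> //.
  move: KSa; rewrite -(ler_nat R) natrD; lra.
rewrite lte_fin /Lambda.
have Sgt : (0 < #|` S|%fset)%N by rewrite cardfs_gt0; apply/fset0Pn; exists x.
have h1 := log2_le Sgt Ss; have h2 := log2_ge mk.
move: KSs; rewrite -(ltr_nat R) natrD [X in _ < X]natrD natrM; lra.
Qed.
End Lambda.
End Reals.

(** * The contradiction *)

Lemma ex_common n m (P : nat -> 'I_n -> 'I_m -> Prop) t0 :
  (forall t t' i j, t <= t' -> P t i j -> P t' i j) ->
  (forall i j, exists t, P t i j) -> exists2 t, t0 <= t & forall i j, P t i j.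
Proof.
move=> mono ex; have [f hf] := choice (fun x : 'I_n * 'I_m => ex x.1 x.2).
exists (maxn t0 (\max_x f x)); first exact: leq_maxl.
move=> i j; apply: mono (hf (i, j)); rewrite leq_max (leq_bigmax_cond (F := f))//.
by rewrite orbT.
Qed.

Section Contradiction.
Variables (R : realType) (U : machine).
Variables (FU : nat -> nat -> nat) (FA : nat -> nat -> nat -> nat -> nat).
Hypothesis UE : forall p y, U p y <->
  exists t, FU t (nat_of_bitstring p) = (nat_of_bitstring y).+1.
Hypothesis FUm : forall p t t', t <= t' -> FU t p != 0 -> FU t' p = FU t p.
Hypothesis FAm : forall x k a t t', t <= t' -> FA t x k a != 0 -> FA t' x k a = FA t x k a.

Definition rejects (x : bitstring) k a := exists t, FA t (nat_of_bitstring x) k a = 1.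

Hypothesis sound : forall (x : bitstring) (k al : nat),
  1 < size x -> k = K U x -> (epsilon R x <= al%:R <= k%:R - epsilon R x)%R ->
  (lambda U x (al%:R - epsilon R x) < (k%:R + 6 * log2 k%:R)%:E)%E%R ->
  ~ rejects x k al.
Hypothesis complete : forall (x : bitstring) (k al : nat),
  1 < size x -> k = K U x -> (epsilon R x <= al%:R <= k%:R - epsilon R x)%R ->
  ((k%:R + 3 * epsilon R x)%:E < lambda U x (al%:R + epsilon R x))%E%R ->
  rejects x k al.

Variable w : bitstring.
Hypothesis wE : forall p y, block_machine FU FA p y <-> U (w ++ p) y.

Local Notation c := (size w).
Local Notation W := (run FU FA c).
Local Notation end_of i q := ((q %/ blk c i).+1 * blk c i).

Lemma lists_ex S : exists p, lists U p S.
Proof.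
have [p Tp] := machine_any FU FA (listing (enum_fset S)).
by exists (w ++ p), (enum_fset S); [exact: perm_refl|apply/wE].
Qed.

Lemma KS_le p S : lists U p S -> KS U S <= size p.
Proof. exact: (shortest_lengthP (lists_ex S)).2. Qed.

Section Slot.
Variables (t q : nat).
Hypotheses (qi : q < 2 ^ idx c) (nz : nth 0 (W t) q != 0).
Local Notation x := (bits (nth 0 (W t) q)).

Lemma slot_program : exists2 p, U p x & size p = kol c 0.
Proof.
have [p sp Tp] := machine_slot qi nz; exists (w ++ p); first exact/wE.
by rewrite size_cat sp /kol; lia.
Qed.

Lemma K_Klt k : K U x < k <-> exists t', Klt FU t' k (nth 0 (W t) q).
Proof.
have [p Up _] := slot_program.
have [[p0 Up0 sp0] Kmin] := shortest_lengthP (ex_intro (U^~ x) p Up).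
split=> [lt|/(KltP UE)[p1 Up1 lt]]; first by apply/(KltP UE); exists p0; rewrite ?sp0.
exact: leq_ltn_trans (Kmin _ Up1) lt.
Qed.

Lemma K_slot : K U x <= kol c 0.
Proof.
have [p Up <-] := slot_program.
by have [_ ] := shortest_lengthP (ex_intro (U^~ x) p Up); apply.
Qed.

Lemma size_slot : size x = len c.
Proof.
have [t0 [_ _ _ sE fE]] := emitted nz.
have le2 : size (W t0) <= 2 ^ idx c by rewrite sE ltnW.
have [/andP[h1 h2] _ _] := fresh_spec FUm t0 le2.
have h0 : 0 < 2 ^ len c by rewrite expn_gt0.
rewrite -(@size_index_string (len c) (nth 0 (W t) q - (2 ^ len c - 1))).
  by rewrite /index_string subnKC// -fE.
by rewrite -fE; lia.
Qed.
End Slot.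

Lemma eps32 : 32 * c.+1 <= eps c. Proof. exact: eps_ge. Qed.

(** The cofactor [8 * c + 20] of [eps c] in [idx c] is [4 * lev c + 4]. This keeps the truncated
    subtraction in [alp] exact at every level. *)
Lemma level_room i : i < lev c -> 4 * eps c * i.+1 + 4 * eps c <= idx c.
Proof.
rewrite /lev /idx => il; have : eps c * (4 * i.+1 + 4) <= eps c * (8 * c + 20).
  by rewrite leq_mul2l; lia.
by rewrite mulnDr; lia.
Qed.

Lemma alpha_range x i : size x = len c -> i < lev c ->
  (epsilon R x <= (alp c i)%:R <= (kol c i)%:R - epsilon R x)%R.
Proof.
move=> /(epsilon_bounds R)/andP[e0 ee] il; have h := level_room il; have h32 := eps32.
have h1 : eps c <= alp c i by rewrite /alp; lia.
have h2 : alp c i + eps c <= kol c i by rewrite /alp /kol; rewrite /lev in il; lia.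
move: h1 h2; rewrite -!(ler_nat R) natrD => h1 h2.
by apply/andP; split; lra.
Qed.

Lemma len_gt1 : 1 < len c.
Proof. by have := eps32; rewrite /len; nia. Qed.

Lemma answered_mono t t' i x : t <= t' -> answered FU FA c i t x -> answered FU FA c i t' x.
Proof.
move=> tt' /orP[/eqP h|/(Klt_mono FUm tt') h]; apply/orP; last by right.
by left; rewrite (FAm tt') ?h.
Qed.

Lemma ready1_mono t t' V q i : t <= t' -> ready1 FU FA c t V q i -> ready1 FU FA c t' V q i.
Proof.
move=> tt' /andP[h1 h2]; apply/andP; split.
  by case/orP: h1 => [->//|/(answered_mono tt') ->]; rewrite orbT.
by case/orP: h2 => [->//|/(Klt_mono FUm tt') ->]; rewrite orbT.
Qed.

Lemma readyP t V q i : ready FU FA c t V -> nth 0 V q != 0 -> i < lev c ->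
  (end_of i q <= size V -> answered FU FA c i t (nth 0 V q)) /\
  (end_of i.+1 q <= size V -> Klt FU t (kol c i) (nth 0 V q)).
Proof.
move=> /allP rd nz il; have := rd q; rewrite mem_iota /= add0n nth_size// => /(_ isT).
rewrite (negbTE nz) /= => /allP/(_ i); rewrite mem_iota add0n il => /(_ isT)/andP[h1 h2].
by split=> h; [move: h1|move: h2]; rewrite h.
Qed.

(* While [x] waits for an answer at level [i], a model of complexity at most
   [alp c i + eps c] announced after [x] would have killed it, and [x] was chosen outside
   the models announced before. *)
Lemma answered_slot t1 q i : (forall t, t1 <= t -> ~~ event FU c t) ->
  q < 2 ^ idx c -> nth 0 (W t1) q != 0 -> i < lev c ->
  K U (bits (nth 0 (W t1) q)) = kol c i ->
  exists t, answered FU FA c i t (nth 0 (W t1) q).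
Proof.
move=> noev qi nz il Kx; apply: contrapT => nans.
set x := nth 0 (W t1) q in nans Kx *.
have sx : size (bits x) = len c := size_slot qi nz.
have [|S [xS KSa Scard]] := @lambda_not_large R U (bits x) (kol c i) (alp c i) (eps c) _
    (epsilon_bounds R sx).
  move=> large; have s1 : 1 < size (bits x) by rewrite sx len_gt1.
  have [t ht] := complete s1 (esym Kx) (alpha_range sx il) large.
  by apply: nans; exists t; rewrite nat_bits in ht; rewrite /answered ht.
have [[p [s sS Us] sp] _] := shortest_lengthP (lists_ex S); rewrite -/(KS U S) in sp.
have [tp htp] := (UE _ _).1 Us.
have [||te ev [lE pE nzE]] := @event_at FU c i (nat_of_bitstring p) il.
- have /andP[_ h] := nat_of_size p; apply: leq_trans h _.
  by rewrite leq_exp2l// sp addn1 ltnS.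
- by exists tp; rewrite htp.
have esE : event_set FU c te = map nat_of_bitstring s.
  rewrite /event_set pE -(FUm (leq_maxl _ tp) nzE).
  by rewrite (FUm (leq_maxr _ tp)) htp//= parse_listing.
have xe : x \in event_set FU c te.
  by rewrite esE -[x]nat_bits map_f// (perm_mem sS).
have sm : small_set FU c te.
  (* Passing from the length of the program to its number costs a factor of two, the [+ 1] in
     [small_set]. *)
  rewrite /small_set esE size_map (perm_size sS) -/(#|` S|%fset) pE.
  have /andP[_ /ltnW h] := nat_of_size p.
  apply: leq_trans (leq_mul (leqnn _) h) _; rewrite sp expnS mulnCA.
  apply: leq_trans (_ : 2 * 2 ^ (kol c i + 3 * eps c) <= _).
    by rewrite leq_mul2l /= ltnW.
  by rewrite -expnS leq_exp2l// /kol; lia.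
have [t0 [t01 ev0 rd0 sE fE]] := emitted nz.
have sE' : size (W t0.+1) = q.+1.
  by rewrite run_step /step (negbTE ev0) rd0 size_rcons sE.
case: (ltngtP te t0) => [lt|gt|teq]; last by rewrite teq (negbTE ev0) in ev.
(* The model was announced before [x] was chosen and is small, so [x] avoided it. *)
- have le0 : size (W t0) <= 2 ^ idx c by rewrite sE ltnW.
  have [_ _ /negP nav] := fresh_spec FUm t0 le0.
  apply: nav; rewrite fE -/x; apply/flattenP; exists (event_set FU c te) => //.
  by apply/mapP; exists te; rewrite ?mem_iota ?add0n//= ev sm.
(* The model was announced after [x] was chosen. As [x] survived this event, the run had left its
   block of level [i], which required the answer. *)
have te1 : te < t1 by rewrite ltnNge; apply/negP => /noev; rewrite ev.
have xE : nth 0 (W te.+1) q = x.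
  rewrite /x (nth_run te1) //; apply: leq_trans (size_run FU FA c (leqW gt)).
  by rewrite sE'.
have alv : nth 0 (W te.+1) q != 0 by rewrite xE.
have [t2 [_ rd2 sE2 xE2]] := passed alv (event_alive ev alv).
have nz2 : nth 0 (W t2) q != 0 by rewrite xE2.
have [+ _] := readyP rd2 nz2 il.
by rewrite sE2 lE xE2 xE => /(_ (leqnn _)) h; apply: nans; exists t2.
Qed.

(* The block of level [i.+1] is itself a model of [x], of complexity at most
   [alp c i - eps c] and nearly optimal for strings of complexity [kol c i]. *)
Lemma rejected_slot t1 q i :
  q < 2 ^ idx c -> nth 0 (W t1) q != 0 -> i < lev c ->
  end_of i.+1 q <= size (W t1) -> size (W t1) <= 2 ^ idx c ->
  K U (bits (nth 0 (W t1) q)) = kol c i ->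
  ~ rejects (bits (nth 0 (W t1) q)) (kol c i) (alp c i).
Proof.
move=> qi nz il eq le2 Kx; set x := nth 0 (W t1) q in Kx *.
have sx : size (bits x) = len c := size_slot qi nz.
have h32 := eps32; have hr := level_room il; have il' := il; rewrite /lev in il'.
have bq : q %/ blk c i.+1 < 2 ^ (idx c - 4 * eps c * i.+1).
  rewrite -(ltn_pmul2r (blk_gt0 c i.+1)) -expnD subnK; last lia.
  by apply: leq_trans le2; apply: leq_trans eq; rewrite ltn_pmul2r ?blk_gt0.
have [|p [S [sp [s sS Tp] Sc Sx]]] := @machine_cover FU FA c i.+1 _ t1 (ltn0Sn i) _ bq eq.
  by lia.
have KSp : KS U S <= c + (c + i.+1 + 2 + (idx c - 4 * eps c * i.+1)).
  by rewrite -sp -size_cat; apply: KS_le; exists s => //; apply/wE.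
apply: sound; rewrite ?sx ?len_gt1// ?Kx//; first exact: alpha_range.
apply: (@lambda_small R U (bits x) (kol c i) (alp c i) (eps c) _ (epsilon_bounds R sx) S (4 *
    eps c * i.+1) (c + 20)).
- exact: Sx.
- by rewrite /alp; lia.
- exact: Sc.
- by rewrite /kol; lia.
- rewrite -/(eps c) /kol; lia.
Qed.

(** By induction on [j], a complete block of level [j] implies K(x) at most [kol c j]. Equality is
    impossible once the block of level [j.+1] is complete, since [answered_slot] would then yield
    the answer 0 that [rejected_slot] excludes. *)
Lemma slot_eventually t1 q i : (forall t, t1 <= t -> ~~ event FU c t) ->
  size (W t1) <= 2 ^ idx c -> nth 0 (W t1) q != 0 -> i < lev c ->
  exists t, ready1 FU FA c t (W t1) q i.
Proof.
move=> noev le2 nz il; set x := nth 0 (W t1) q.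
have qi : q < 2 ^ idx c by apply: leq_trans le2; exact: nth_size.
have KE k : K U (bits x) < k -> exists t, Klt FU t k x by move/(K_Klt qi nz).
have H : forall j, j < lev c ->
    (end_of j q <= size (W t1) -> K U (bits x) <= kol c j) /\
    (end_of j.+1 q <= size (W t1) -> K U (bits x) < kol c j).
  elim=> [|j IH] jl.
    have K0 := K_slot qi nz; split=> // e1.
    rewrite ltn_neqAle K0 andbT; apply/eqP => Kx.
    have [t /orP[/eqP h|h]] := answered_slot noev qi nz jl Kx; last first.
      by have : K U (bits x) < kol c 0 by [apply/(K_Klt qi nz); exists t]; rewrite -Kx ltnn.
    by apply: (rejected_slot qi nz jl e1 le2 Kx); exists t; rewrite nat_bits.
  have [_ Kj] := IH (ltnW jl); split=> [/Kj|].
    by rewrite /kol; rewrite /lev in jl; lia.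
  move=> e1; have e0 := leq_trans (end_of_mono c q (leqnSn j.+1)) e1.
  have K0 : K U (bits x) <= kol c j.+1.
    by have := Kj e0; rewrite /kol; rewrite /lev in jl; lia.
  rewrite ltn_neqAle K0 andbT; apply/eqP => Kx.
  have [t /orP[/eqP h|h]] := answered_slot noev qi nz jl Kx; last first.
    by have : K U (bits x) < kol c j.+1 by [apply/(K_Klt qi nz); exists t]; rewrite -Kx ltnn.
  by apply: (rejected_slot qi nz jl e1 le2 Kx); exists t; rewrite nat_bits.
have [Hle Hlt] := H i il.
have [ta hta] : exists t, end_of i q <= size (W t1) -> answered FU FA c i t x.
  case: leqP => [/Hle|_]; last by exists 0.
  rewrite leq_eqVlt => /predU1P[Kx|/KE[t ht]].
    by have [t ht] := answered_slot noev qi nz il Kx; exists t.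
  by exists t => _; rewrite /answered ht orbT.
have [tb htb] : exists t, end_of i.+1 q <= size (W t1) -> Klt FU t (kol c i) x.
  by case: leqP => [/Hlt/KE[t ht]|_]; [exists t|exists 0].
exists (maxn ta tb); apply/andP; split.
  by case: leqP hta => //= _ /(_ isT); apply: answered_mono; exact: leq_maxl.
by case: leqP htb => //= _ /(_ isT); apply: Klt_mono FUm _ _ _ _ _; exact: leq_maxr.
Qed.

(** There are finitely many pairs of a level and a program, with at most one event each. *)
Lemma events_end : exists t1, forall t, t1 <= t -> ~~ event FU c t.
Proof.
have ex (x : 'I_(lev c) * 'I_(nprog c)) : exists m, forall t, event FU c t ->
    lev_at c t = x.1 -> prg_at c t = x.2 -> t <= m.
  have [[t [ev l p]]|no] := pselect (exists t, [/\ event FU c t, lev_at c t = x.1 & prg_at c t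
      = x.2]).
    by exists t => t' ev' l' p'; rewrite (event_inj FUm ev' ev) ?l ?p.
  by exists 0 => t ev l p; case: no; exists t.
have [f hf] := choice ex.
exists (\max_x f x).+1 => t; apply: contraL => ev; rewrite -ltnNge ltnS.
pose x := (Ordinal (lev_at_lt c t), Ordinal (ltn_pmod (t %/ lev c) (nprog_gt0 c))).
by apply: leq_trans (leq_bigmax_cond (F := f) x _) => //; exact: hf.
Qed.

(* Otherwise the run is eventually constant and every condition it waits for is met. *)
Lemma progress t : size (W t) <= 2 ^ idx c -> exists t', size (W t) < size (W t').
Proof.
move=> le2; apply: contrapT => stuck.
have sz t' : t <= t' -> size (W t') = size (W t).
  move=> /(size_run FU FA c) le; apply/eqP; rewrite eqn_leq le andbT leqNgt.
  by apply/negP => lt; apply: stuck; exists t'.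
have [te noev'] := events_end.
pose t1 := maxn t te.
have noev t' : t1 <= t' -> ~~ event FU c t'.
  by move=> h; apply: noev'; apply: leq_trans h; exact: leq_maxr.
have tt1 : t <= t1 := leq_maxl _ _.
have nrd t' : t1 <= t' -> ~~ ready FU FA c t' (W t').
  move=> h; apply/negP => rd.
  have := sz t'.+1 (leqW (leq_trans tt1 h)).
  rewrite run_step /step (negbTE (noev _ h)) rd size_rcons (sz t' (leq_trans tt1 h)).
  by lia.
have const t' : t1 <= t' -> W t' = W t1.
  elim: t' => [|t' IH]; first by rewrite leqn0 => /eqP ->.
  rewrite leq_eqVlt => /predU1P[->//|/ltnSE h].
  by rewrite run_step /step (negbTE (noev _ h)) (negbTE (nrd _ h)) IH.
pose P t' (q : 'I_(size (W t1))) (i : 'I_(lev c)) :=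
  (nth 0 (W t1) q == 0) || ready1 FU FA c t' (W t1) q i.
have Pmono s s' q i : s <= s' -> P s q i -> P s' q i.
  by move=> ss' /orP[h|/(ready1_mono ss') h]; apply/orP; [left|right].
have Pex q i : exists t', P t' q i.
  rewrite /P; case: (eqVneq (nth 0 (W t1) q) 0) => [_|nz]; first by exists 0.
  by apply: (slot_eventually noev _ nz (ltn_ord i)); rewrite sz.
have [t2 t12 h2] := ex_common t1 Pmono Pex.
have /negP := nrd t2 t12; rewrite const//; apply.
apply/allP => q; rewrite mem_iota add0n /= => qs.
have [_|nz] := eqVneq (nth 0 (W t1) q) 0; first by [].
apply/allP => i; rewrite mem_iota add0n /= => il.
by have := h2 (Ordinal qs) (Ordinal il); rewrite /P /= (negbTE nz).
Qed.

Lemma run_ends : exists t, 2 ^ idx c < size (W t).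
Proof.
apply: contrapT => no.
have le2 t : size (W t) <= 2 ^ idx c.
  by rewrite leqNgt; apply/negP => h; apply: no; exists t.
have grow n : exists t, n <= size (W t).
  elim: n => [|n [t nt]]; first by exists 0.
  by have [t' lt] := progress (le2 t); exists t'; exact: leq_ltn_trans nt lt.
by have [t] := grow (2 ^ idx c).+1; rewrite ltnNge le2.
Qed.

Lemma no_decision_procedure : False.
Proof.
(* At the first such time all earlier sizes obey the bound assumed by [dead_le]. *)
case: (ex_minnP run_ends) => t big tmin.
have dead : count (pred1 0) (W t) <= 2 ^ (idx c - 1).
  apply: dead_le => // t' lt; rewrite leqNgt; apply/negP => /tmin.
  by rewrite leqNgt lt.
pose g q := nth 0 (W t) q; pose Q := [seq q <- iota 0 (2 ^ idx c) | g q != 0].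
have idx1 : 1 <= idx c by have := eps32; rewrite /idx; nia.
have sizeQ : 2 ^ (idx c - 1) <= size Q.
  have E : take (2 ^ idx c) (W t) = map g (iota 0 (2 ^ idx c)).
    rewrite -[LHS](mkseq_nth 0) size_takel ?(ltnW big)//.
    by apply/eq_in_map => q; rewrite mem_iota add0n => /= lt; rewrite nth_take.
  have : count (pred1 0) (map g (iota 0 (2 ^ idx c))) <= 2 ^ (idx c - 1).
    rewrite -E; apply: leq_trans dead.
    by rewrite -[W t in leqRHS](cat_take_drop (2 ^ idx c)) count_cat leq_addr.
  rewrite count_map => hd.
  have hs := count_predC (fun q => g q == 0) (iota 0 (2 ^ idx c)).
  have {}hd : count (fun q => g q == 0) (iota 0 (2 ^ idx c)) <= 2 ^ (idx c - 1) by [].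
  have -> : size Q = count (predC (fun q => g q == 0)) (iota 0 (2 ^ idx c)).
    by rewrite size_filter.
  have h2 : 2 ^ idx c = 2 * 2 ^ (idx c - 1) by rewrite -expnS; congr (2 ^ _); lia.
  move: hd hs; rewrite size_iota h2; lia.
have QP q : q \in Q -> q < 2 ^ idx c /\ g q != 0.
  by rewrite mem_filter mem_iota add0n => /andP[-> /andP[_ ->]].
have : size [seq g q | q <- Q] <= 2 ^ kol c (lev c).-1 - 1.
  apply: (count_Klt FUm).
    rewrite map_inj_in_uniq ?filter_uniq ?iota_uniq// => q q' /QP[_ nz] _.
    exact: emitted_uniq nz.
  move=> x /mapP[q /QP[lt nz] ->].
  (* [2 ^ idx c] is a multiple of the block size of level [lev c], so the run has left every block
     among the first [2 ^ idx c] slots. *)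
  have le : end_of (lev c) q <= 2 ^ idx c.
    apply: end_of_le lt; apply: dvdn_exp2l.
    have := level_room (i := (lev c).-1); rewrite prednK ?lev_gt0//.
    by move=> /(_ (leqnn _)); lia.
  have [t' [_ rd sE xE]] := passed nz (leq_ltn_trans le big).
  have nz' : nth 0 (W t') q != 0 by rewrite xE.
  have pl : (lev c).-1 < lev c by rewrite prednK ?lev_gt0.
  have [_] := readyP rd nz' pl; rewrite prednK ?lev_gt0// sE => /(_ (leqnn _)).
  by rewrite xE; exists t'.
rewrite size_map; have : 0 < 2 ^ (idx c - 1) by rewrite expn_gt0.
(* The choice of [lev c] serves this equation: the last level [2 * c + 3] offsets the header cost
   [2 * c + 2] and one bit more. *)
have -> : kol c (lev c).-1 = idx c - 1 by rewrite /kol /lev; lia.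
lia.
Qed.
End Contradiction.

(** * Staged forms of the given partial functions, and the theorem *)

Lemma staged_Comp1 (f : 1.-tuple nat -> nat -> Prop) : partial_recursive f ->
  exists F : nat -> nat -> nat, [/\ Comp (fun p : nat * nat => F p.1 p.2),
    forall x y, f [tuple x] y <-> exists t, F t x = y.+1
  & forall x t t', t <= t' -> F t x != 0 -> F t' x = F t x].
Proof.
move=> /staged_ex[F [rF FE Fm]]; exists (fun t x => F [tuple of t :: [tuple x]]); split.
- exists (fun z => F [tuple of cfst z :: [tuple csnd z]]); last first.
    by move=> [t x]; rewrite [cfst _]cpairK1 [csnd _]cpairK2.
  apply: rec_ext (rec_comp (h := fun (i : 'I_2) v => if val i is 0 then cfst (thead v) else
      csnd (thead v)) rF _).
    by move=> v; congr F; apply: eq_from_tnth => -[[|[|k]] i2] //; rewrite tnth_mktuple.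
  by move=> -[[|[|k]] i2] //=; [exact: Rec_cfst|exact: Rec_csnd].
- by move=> x y; exact: FE.
- by move=> x; exact: Fm.
Qed.

Lemma staged_Comp3 (f : 3.-tuple nat -> nat -> Prop) : partial_recursive f ->
  exists F : nat -> nat -> nat -> nat -> nat,
  [/\ Comp (fun p : nat * nat * nat * nat => F p.1.1.1 p.1.1.2 p.1.2 p.2),
    forall x k a y, f [tuple x; k; a] y <-> exists t, F t x k a = y.+1
  & forall x k a t t', t <= t' -> F t x k a != 0 -> F t' x k a = F t x k a].
Proof.
move=> /staged_ex[F [rF FE Fm]].
exists (fun t x k a => F [tuple of t :: [tuple x; k; a]]); split.
- exists (fun z => F [tuple of cfst (cfst (cfst z)) :: [tuple csnd (cfst (cfst z));
    csnd (cfst z); csnd z]]); last first.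
    by move=> [[[t x] k] a]; rewrite /encode /= /codable_prod /= !cpairK1 !cpairK2.
  apply: rec_ext (rec_comp (h := fun (i : 'I_4) v => nth 0
    [:: cfst (cfst (cfst (thead v))); csnd (cfst (cfst (thead v))); csnd (cfst (thead v));
        csnd (thead v)] i) rF _).
    by move=> v; congr F; apply: eq_from_tnth => -[[|[|[|[|k]]]] i2] //; rewrite tnth_mktuple.
  move=> -[[|[|[|[|k]]]] i2] //=.
  + exact: Rec_comp Rec_cfst (Rec_comp Rec_cfst Rec_cfst).
  + exact: Rec_comp Rec_csnd (Rec_comp Rec_cfst Rec_cfst).
  + exact: Rec_comp Rec_csnd Rec_cfst.
  + exact: Rec_csnd.
- by move=> x k a y; exact: FE.
- by move=> x k a; exact: Fm.
Qed.

Local Open Scope ring_scope.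

Theorem mainTheorem13 (R : realType) (U : machine)
    (hU : universal_prefix_machine U) :
  ~ exists A : 3.-tuple nat -> nat -> Prop,
      partial_recursive A /\
      forall (x : bitstring) (k alpha : nat),
        (1 < size x)%N ->
        k = K U x ->
        epsilon R x <= alpha%:R <= k%:R - epsilon R x ->
        ((lambda U x (alpha%:R - epsilon R x)
            < (k%:R + 6 * log2 k%:R)%:E)%E ->
          A [tuple nat_of_bitstring x; k; alpha] 1%N) /\
        (((k%:R + 3 * epsilon R x)%:E
            < lambda U x (alpha%:R + epsilon R x))%E ->
          A [tuple nat_of_bitstring x; k; alpha] 0%N).
Proof.
move=> [A [rA hA]]; case: hU => -[[f rf fE] _] univ.
have [FU [cFU FUE FUm]] := staged_Comp1 rf.
have [FA [cFA FAE FAm]] := staged_Comp3 rA.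
(* The length of [w] is known only after the machine is fixed. The machine therefore reads [c] from
   its program, and the run is considered for [c = size w]. *)
have [w wE] := univ _ (block_machine_prefix_machine cFU cFA).
apply: (@no_decision_procedure R U FU FA _ FUm FAm _ _ w wE).
- by move=> p y; rewrite fE; exact: FUE.
(* The required answer is 1, and [A] has at most one value. *)
- move=> x k al s1 kE rg /(proj1 (hA x k al s1 kE rg)) A1 /FAE A0.
  by have := pr_functional rA A0 A1.
- by move=> x k al s1 kE rg /(proj2 (hA x k al s1 kE rg)) A0; apply/FAE.
Qed.
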